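(* Let $\mathbb{M}=(M_p)_{p\in\mathbb{N}_0}$ be a sequence of positive real numbers with $M_0=1$ which is logarithmically convex, whose sequence of quotients $m_p=M_{p+1}/M_p$ satisfies $\lim_{p\to\infty}m_p=\infty$, and which admits a nonzero proximate order. Let $\gamma>0$, let $G_\gamma$ be a sectorial region with bisecting direction $0$ and opening $\pi\gamma$, and let $\theta\in(-\pi\gamma/2,\pi\gamma/2)$. Then $\tilde{\mathcal{A}}_{\mathbb{M}}(G_\gamma)$ equals the set of all functions $f$ holomorphic in $G_\gamma$ such that $f$ is bounded in every proper bounded subsector $T$ of $G_\gamma$ and $f$ admits an $\mathbb{M}$-asymptotic expansion in direction $\theta$.
   Context: $\mathbb{N}_0=\{0,1,2,\dots\}$. $\mathcal{R}$ is the Riemann surface of the logarithm (the vertex $0$ does not belong to it; closures are taken in $\mathcal{R}$). For $d\in\mathbb{R}$ and $\gamma,r>0$, $S(d,\gamma,r)=\{z\in\mathcal{R}:|\arg(z)-d|<\pi\gamma/2,\ |z|<r\}$ and $S(d,\gamma)=\{z\in\mathcal{R}:|\arg(z)-d|<\pi\gamma/2\}$. A sectorial region $G_\gamma$ with bisecting direction $0$ and opening $\pi\gamma$ is an open connected set $G_\gamma\subset S(0,\gamma)$ such that for every $\beta\in(0,\gamma)$ there is $\rho=\rho(\beta)>0$ with $S(0,\beta,\rho)\subset G_\gamma$. A proper bounded subsector $T$ of $G_\gamma$, written $T\ll G_\gamma$, is a bounded sector (of the form $S(d',\gamma',r')$) with $\overline{T}\subset G_\gamma$ (closure in $\mathcal{R}$).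 $\mathbb{M}$ is logarithmically convex if $M_p^2\le M_{p-1}M_{p+1}$ for all $p\ge1$. For $t>0$ put $M(t)=\sup_{p\in\mathbb{N}_0}\log(t^p/M_p)$ and, for $t$ large, $d_{\mathbb{M}}(t)=\log(M(t))/\log(t)$. A proximate order is a real function $\rho(r)$ on some $(c,\infty)$, $c\ge0$, such that: (A) $\rho$ is continuous and piecewise continuously differentiable (differentiable except possibly at a sequence of points tending to infinity, at each of which it is continuous and has distinct finite one-sided derivatives); (B) $\rho(r)\ge0$ for all $r>c$; (C) $\lim_{r\to\infty}\rho(r)=\rho<\infty$; (D) $\lim_{r\to\infty}r\rho'(r)\ln r=0$. It is nonzero if the limit $\rho$ in (C) is positive. $\mathbb{M}$ admits a nonzero proximate order if there are a nonzero proximate order $\rho(t)$ and real constants $A,B$ such that $A\le\log(t)\,(\rho(t)-d_{\mathbb{M}}(t))\le B$ for all $t$ large enough. $f$ has $\mathbb{M}$-asymptotic expansion $\hat f=\sum_{n\ge0}a_nz^n\in\mathbb{C}[[z]]$ in direction $\theta$ if there exist $r_\theta,C_\theta,A_\theta>0$ such that the segment $(0,r_\theta e^{i\theta}]$ (points of $\mathcal{R}$ with argument $\theta$ and modulus in $(0,r_\theta]$) is contained in $G_\gamma$ and $|f(z)-\sum_{n=0}^{p-1}a_nz^n|\le C_\theta A_\theta^pM_p|z|^p$ for all $z$ in that segment and all $p\in\mathbb{N}_0$. $f$ admits an $\mathbb{M}$-asymptotic expansion in direction $\theta$ if this holds for some $\hat f$. $\tilde{\mathcal{A}}_{\mathbb{M}}(G_\gamma)$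 is the space of functions $f$ holomorphic in $G_\gamma$ for which there is a formal power series $\sum_{n\ge0}a_nz^n\in\mathbb{C}[[z]]$ such that for every $T\ll G_\gamma$ there exist $C_T,A_T>0$ with $|f(z)-\sum_{n=0}^{p-1}a_nz^n|\le C_TA_T^pM_p|z|^p$ for all $z\in T$ and all $p\in\mathbb{N}_0$. *)

(* Defs.v *)
From Stdlib Require Import Reals List.
From Coquelicot Require Import Coquelicot.

Open Scope R_scope.

(** * The Riemann surface of the logarithm *)

(* The surface is the universal covering of C \ {0} by exp : C -> C \ {0}.
   A point z is stored as the pair (ln |z|, arg z) of R * R, so that the
   topology is that of the plane and the vertex 0 is not a point. *)
Definition log_surface : UniformSpace :=
  prod_UniformSpace R_UniformSpace R_UniformSpace.

Definition modulus (z : log_surface) : R := exp (fst z).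
Definition arg (z : log_surface) : R := snd z.

(* The covering map onto C \ {0}; its local inverses are the charts. *)
Definition proj (z : log_surface) : C :=
  (modulus z * cos (arg z), modulus z * sin (arg z)).

Definition closure (A : log_surface -> Prop) (z : log_surface) : Prop :=
  forall U : log_surface -> Prop, locally z U -> exists w, U w /\ A w.

Definition connected (A : log_surface -> Prop) : Prop :=
  forall U V : log_surface -> Prop, open U -> open V ->
    (forall z, A z -> U z \/ V z) ->
    (exists z, A z /\ U z) -> (exists z, A z /\ V z) ->
    exists z, A z /\ U z /\ V z.

(* Complex differentiability with respect to the projected variable. The
   quotient is meaningful near z because proj is locally injective. *)
Definition holomorphic_on (f : log_surface -> C) (G : log_surface -> Prop)
  : Prop :=
  forall z, G z -> exists l : C,
    filterlim
      (fun w : log_surface => ((f w - f z) / (proj w - proj z))%C : C_UniformSpace)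
      (locally' z) (locally (l : C_UniformSpace)).

(** * Sectors and sectorial regions *)

Definition unbounded_sector (d gamma : R) (z : log_surface) : Prop :=
  Rabs (arg z - d) < PI * gamma / 2.

Definition sector (d gamma r : R) (z : log_surface) : Prop :=
  Rabs (arg z - d) < PI * gamma / 2 /\ modulus z < r.

Definition sectorial_region (gamma : R) (G : log_surface -> Prop) : Prop :=
  open G /\ connected G /\
  (forall z, G z -> unbounded_sector 0 gamma z) /\
  (forall beta, 0 < beta < gamma ->
     exists rho, 0 < rho /\ forall z, sector 0 beta rho z -> G z).

Definition proper_bounded_subsector (T G : log_surface -> Prop) : Prop :=
  (exists d gamma r, 0 < gamma /\ 0 < r /\
     forall z, T z <-> sector d gamma r z) /\
  (forall z, closure T z -> G z).

(** * Weight sequences and proximate orders *)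

Definition log_convex (M : nat -> R) : Prop :=
  forall p : nat, (1 <= p)%nat -> M p ^ 2 <= M (p - 1)%nat * M (p + 1)%nat.

Definition quotients (M : nat -> R) (p : nat) : R := M (p + 1)%nat / M p.

(* M(t) = sup_p log (t^p / M_p), for t > 0.  The supremum is finite when the
   quotients of M tend to infinity; [real] sends an infinite one to 0. *)
Definition assoc_fun (M : nat -> R) (t : R) : R :=
  real (Sup_seq (fun p => Finite (ln (t ^ p / M p)))).

Definition d_order (M : nat -> R) (t : R) : R := ln (assoc_fun M t) / ln t.

(* E is the set of exceptional points in (c, +oo): a finite set, or the range
   of a sequence tending to infinity, i.e. finite below every bound. *)
Definition discrete_to_infinity (c : R) (E : R -> Prop) : Prop :=
  (forall x, E x -> c < x) /\
  (forall b : R, exists l : list R, forall x, E x -> x <= b -> In x l).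

Definition distinct_one_sided_derivatives (rho : R -> R) (x : R) : Prop :=
  exists a b : R, a <> b /\
    filterlim (fun y => (rho y - rho x) / (y - x)) (at_left x) (locally a) /\
    filterlim (fun y => (rho y - rho x) / (y - x)) (at_right x) (locally b).

Definition piecewise_C1 (c : R) (rho : R -> R) : Prop :=
  exists E : R -> Prop, discrete_to_infinity c E /\
    (forall x, c < x -> ~ E x ->
       ex_derive rho x /\ continuous (Derive rho) x) /\
    (forall x, E x -> distinct_one_sided_derivatives rho x).

(* Only the values of rho on (c, +oo) matter.  In the last clause the limit is
   taken along the points where rho is differentiable. *)
Definition proximate_order (rho : R -> R) (lim_rho : R) : Prop :=
  exists c : R, 0 <= c /\
    (forall x, c < x -> continuous rho x) /\
    piecewise_C1 c rho /\
    (forall x, c < x -> 0 <= rho x) /\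
    is_lim rho p_infty lim_rho /\
    filterlim (fun x => x * Derive rho x * ln x)
      (within (fun x => ex_derive rho x) (Rbar_locally p_infty)) (locally 0).

Definition nonzero_proximate_order (rho : R -> R) : Prop :=
  exists lim_rho : R, proximate_order rho lim_rho /\ 0 < lim_rho.

Definition admits_nonzero_proximate_order (M : nat -> R) : Prop :=
  exists rho : R -> R, nonzero_proximate_order rho /\
    exists A B : R, Rbar_locally p_infty
      (fun t => A <= ln t * (rho t - d_order M t) <= B).

(** * Asymptotic expansions *)

(* sum_{n < p} a_n z^n, empty when p = 0. *)
Fixpoint partial_sum (a : nat -> C) (z : C) (p : nat) : C :=
  match p with
  | O => RtoC 0
  | S q => (partial_sum a z q + a q * z ^ q)%C
  end.

Definition expansion_on (M : nat -> R) (f : log_surface -> C) (a : nat -> C)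
    (T : log_surface -> Prop) (K A : R) : Prop :=
  forall z, T z -> forall p : nat,
    Cmod (f z - partial_sum a (proj z) p) <= K * A ^ p * M p * modulus z ^ p.

Definition segment (theta r : R) (z : log_surface) : Prop :=
  arg z = theta /\ modulus z <= r.

Definition has_expansion_in_direction (M : nat -> R) (G : log_surface -> Prop)
    (f : log_surface -> C) (a : nat -> C) (theta : R) : Prop :=
  exists r K A : R, 0 < r /\ 0 < K /\ 0 < A /\
    (forall z, segment theta r z -> G z) /\
    expansion_on M f a (segment theta r) K A.

Definition admits_expansion_in_direction (M : nat -> R)
    (G : log_surface -> Prop) (f : log_surface -> C) (theta : R) : Prop :=
  exists a : nat -> C, has_expansion_in_direction M G f a theta.

(* Membership in the space of functions on G; it depends only on the values of
   f on G. *)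
Definition A_tilde (M : nat -> R) (G : log_surface -> Prop)
    (f : log_surface -> C) : Prop :=
  holomorphic_on f G /\
  exists a : nat -> C, forall T, proper_bounded_subsector T G ->
    exists K A : R, 0 < K /\ 0 < A /\ expansion_on M f a T K A.

Definition bounded_on (f : log_surface -> C) (T : log_surface -> Prop) : Prop :=
  exists K : R, forall z, T z -> Cmod (f z) <= K.

(* Main.v *)
Require Import Defs.
From Stdlib Require Import Reals Lra Lia Classical ClassicalEpsilon.
From Coquelicot Require Import Coquelicot.
Open Scope R_scope.

(* Work in the variable w = log z, so that sectors become half-strips, and let
   m_p = M_(p+1) / M_p.  The proximate order makes the function M(t) at least
   double when t is multiplied by a suitable constant; evaluated at t = m_p this
   gives m_p^p <= D^p M_p, hence m_(kq)^q <= D^(kq) M_q for every k.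

   Let g_p be the difference of f and the p-th partial sum.  For |z| <= 1 / (B m_p)
   it is bounded by a constant independent of p, and on the direction theta it is
   bounded by (B m_p |z|)^p up to a constant.  The two-constants theorem on the
   half-strip between theta and another direction Y interpolates:
   |g_p(z)| <= C (B m_p |z|)^(p lambda), where lambda decreases linearly from 1 at
   theta to 0 at Y.  Away from Y one has lambda >= 1 / k, so taking p = k q gives
   the bound of order q.  The terms from q to p are harmless for these z, and for
   |z| > 1 / (B m_p) the estimate follows from the boundedness of f. *)

(** * Complex differentiability *)

(** Doubling is enough because the supremum defining M(m_p) is attained at index p: passing from m_p
    to m_p / H lowers that term by p log H only, while M at least halves, so M(m_p) <= 2 p log H.

    The remainder of order q cannot be interpolated directly: the two-constants theorem turns an
    exponent p on theta into p lambda, with lambda < 1 inside the strip. Starting from order p = k q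
    pays for this loss at the price of meeting m_(kq), and the bound on m_(kq)^q says that this
    price is geometric in q. The strip used for q ends at |z| = 1 / (B m_p), so every constant must
    be uniform in p.

    Since lambda has to stay away from 0 on both sides of theta, there are two half-strips, ending
    at opposite directions strictly beyond the arguments of T. A sectorial region contains such
    strips only near the vertex; the rest of T is left to boundedness. Rectangles exhaust a
    half-strip, so a maximum principle on rectangles suffices, and it rests on Goursat's theorem and
    on the sign of the imaginary part of the integral of 1 / (z - p). *)

Definition cdiff (F : C -> C) (z : C) : Prop :=
  ex_derive (K := C_AbsRing) (V := AbsRing_NormedModule C_AbsRing) F z.

Definition ccont (g : C -> C) (z : C) : Prop :=
  forall eps, 0 < eps -> exists delta, 0 < delta /\
    forall w, Cmod (w - z) < delta -> Cmod (g w - g z) < eps.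

(** With [C] as a normed module over itself, balls are discs for [Cmod], so differentiability
    becomes an explicit remainder estimate. *)
Lemma cdiff_eps (F : C -> C) (z : C) :
  cdiff F z <->
  exists l : C, forall eps, 0 < eps -> exists delta, 0 < delta /\
    forall w, Cmod (w - z) < delta ->
      Cmod (F w - F z - l * (w - z)) <= eps * Cmod (w - z).
Proof.
  split.
  - intros [l [_ Hl]]. exists l. intros eps Heps.
    destruct (Hl z (fun P H => H) (mkposreal eps Heps)) as [d Hd].
    exists d. split; [apply cond_pos|]. intros w Hw.
    generalize (Hd w Hw).
    replace (F w - F z - l * (w - z))%C with (F w - F z - (w - z) * l)%C by ring.
    exact (fun x => x).
  - intros [l Hl]. exists l. split.
    + apply (is_linear_scal_l (V := AbsRing_NormedModule C_AbsRing)).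
    + intros x Hx eps.
      assert (E : z = x) by exact (is_filter_lim_locally_unique (V := AbsRing_NormedModule C_AbsRing) z x Hx).
      subst x.
      destruct (Hl eps (cond_pos eps)) as [d [Hd H]].
      exists (mkposreal d Hd). intros w Hw. generalize (H w Hw).
      replace (F w - F z - l * (w - z))%C with (F w - F z - (w - z) * l)%C by ring.
      exact (fun x => x).
Qed.

Lemma cdiff_const (c z : C) : cdiff (fun _ => c) z.
Proof. apply (ex_derive_const (V := AbsRing_NormedModule C_AbsRing)). Qed.

Lemma cdiff_id (z : C) : cdiff (fun w => w) z.
Proof. apply (ex_derive_id (K := C_AbsRing)). Qed.

Lemma cdiff_plus (F G : C -> C) (z : C) :
  cdiff F z -> cdiff G z -> cdiff (fun w => F w + G w)%C z.
Proof. apply (ex_derive_plus (V := AbsRing_NormedModule C_AbsRing)). Qed.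

Lemma cdiff_minus (F G : C -> C) (z : C) :
  cdiff F z -> cdiff G z -> cdiff (fun w => F w - G w)%C z.
Proof. apply (ex_derive_minus (V := AbsRing_NormedModule C_AbsRing)). Qed.

Lemma cdiff_mult (F G : C -> C) (z : C) :
  cdiff F z -> cdiff G z -> cdiff (fun w => F w * G w)%C z.
Proof.
  intros [l Hl] [k Hk]. eexists.
  apply (is_derive_mult (K := C_AbsRing) F G z l k Hl Hk Cmult_comm).
Qed.

Lemma cdiff_pow (F : C -> C) (z : C) (n : nat) :
  cdiff F z -> cdiff (fun w => F w ^ n)%C z.
Proof.
  intros H. induction n as [|n IH].
  - exact (cdiff_const 1 z).
  - exact (cdiff_mult F (fun w => F w ^ n)%C z H IH).
Qed.

Lemma cdiff_comp (F G : C -> C) (z : C) :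
  cdiff F (G z) -> cdiff G z -> cdiff (fun w => F (G w)) z.
Proof.
  intros [l Hl] [k Hk]. eexists.
  apply (is_derive_comp (V := AbsRing_NormedModule C_AbsRing) F G z l k Hl Hk).
Qed.

Lemma cdiff_ccont (F : C -> C) (z : C) : cdiff F z -> ccont F z.
Proof.
  intros H eps Heps.
  assert (Hc := ex_derive_continuous (V := AbsRing_NormedModule C_AbsRing) F z H).
  destruct (proj1 (filterlim_locally (U := AbsRing_UniformSpace C_AbsRing) F (F z)) Hc (mkposreal eps Heps)) as [d Hd].
  exists d. split; [apply cond_pos|]. exact Hd.
Qed.

Lemma Cmod_minus_sym (z w : C) : Cmod (z - w) = Cmod (w - z).
Proof. rewrite <- Cmod_opp. f_equal. ring. Qed.

Lemma Cmod_triangle_minus (z w : C) : Cmod (z - w) <= Cmod z + Cmod w.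
Proof. unfold Cminus. rewrite <- (Cmod_opp w). apply Cmod_triangle. Qed.

Lemma Cmod_triangle_inv (z w : C) : Cmod z - Cmod w <= Cmod (z - w).
Proof.
  assert (H := Cmod_triangle (z - w) w).
  replace (z - w + w)%C with z in H by ring. lra.
Qed.

Lemma Im_le_Cmod (z : C) : Rabs (Im z) <= Cmod z.
Proof. eapply Rle_trans; [apply Rmax_r|apply Rmax_Cmod]. Qed.

Lemma Cmod_le_Rabs (x y : R) : Cmod (x, y) <= Rabs x + Rabs y.
Proof.
  replace ((x, y) : C) with (x + Ci * y)%C.
  - eapply Rle_trans; [apply Cmod_triangle|].
    rewrite Cmod_mult, Cmod_Ci, !Cmod_R. lra.
  - unfold Ci, RtoC, Cmult, Cplus; simpl. f_equal; ring.
Qed.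

Lemma cdiff_inv (z : C) : z <> 0 -> cdiff Cinv z.
Proof.
  intros Hz. apply cdiff_eps. exists (- / (z * z))%C. intros eps Heps.
  assert (Hm : 0 < Cmod z) by now apply Cmod_gt_0.
  (* The first bound keeps |w| >= |z| / 2, so the remainder (w - z)^2 / (w z^2) is at most 2 |w -
     z|^2 / |z|^3; the second makes this at most eps |w - z|. *)
  exists (Rmin (Cmod z / 2) (eps * Cmod z ^ 3 / 2)). split.
  - apply Rmin_pos; [lra|]. apply Rdiv_lt_0_compat; [|lra].
    apply Rmult_lt_0_compat; [lra|]. now apply pow_lt.
  - intros w Hw.
    assert (H1 := Rlt_le_trans _ _ _ Hw (Rmin_l _ _)).
    assert (H2 := Rlt_le_trans _ _ _ Hw (Rmin_r _ _)).
    assert (H3 : Cmod z / 2 <= Cmod w).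
    { assert (H := Cmod_triangle_inv z w). rewrite Cmod_minus_sym in H. lra. }
    assert (Hw0 : w <> 0) by (apply Cmod_gt_0; lra).
    replace (/ w - / z - - / (z * z) * (w - z))%C
      with ((w - z) * (w - z) * / (w * (z * z)))%C by (field; auto).
    rewrite !Cmod_mult, Cmod_inv, !Cmod_mult
      by (repeat apply Cmult_neq_0; assumption).
    rewrite Rmult_comm, <- Rmult_assoc. apply Rmult_le_compat_r; [apply Cmod_ge_0|].
    assert (Hp : 0 < Cmod w * (Cmod z * Cmod z)) by (apply Rmult_lt_0_compat; nra).
    apply (Rmult_le_reg_l _ _ _ Hp). rewrite <- Rmult_assoc, Rinv_r, Rmult_1_l by lra.
    apply Rle_trans with (1 := Rlt_le _ _ H2).
    replace (eps * Cmod z ^ 3 / 2) with ((Cmod z / 2) * (Cmod z * Cmod z) * eps) by (simpl; field).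
    apply Rmult_le_compat_r; [lra|]. apply Rmult_le_compat_r; nra.
Qed.

(** A point stored as (ln |z|, arg z), read as a complex number, is the logarithm of z; the covering
    map is then the complex exponential itself. *)
Definition cexp : C -> C := proj.

Lemma cexp_plus (z w : C) : cexp (z + w) = (cexp z * cexp w)%C.
Proof.
  destruct z as [x y], w as [u v].
  unfold cexp, proj, modulus, arg, Cplus, Cmult; simpl.
  rewrite exp_plus, cos_plus, sin_plus. f_equal; ring.
Qed.

Lemma Cmod_cexp (z : C) : Cmod (cexp z) = exp (fst z).
Proof.
  destruct z as [x y]. unfold cexp, proj, modulus, arg, Cmod; simpl.
  transitivity (sqrt (Rsqr (exp x))); [f_equal|apply sqrt_Rsqr; left; apply exp_pos].
  assert (H := sin2_cos2 y). unfold Rsqr in *.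
  transitivity (exp x * exp x * (sin y * sin y + cos y * cos y)); [ring|].
  rewrite H. ring.
Qed.

Lemma exp_sub_1_bound (x : R) : Rabs x <= 1 -> Rabs (exp x - 1) <= 3 * Rabs x.
Proof.
  intros Hx.
  destruct (MVT_cor4 exp exp 0 1 (fun c _ => is_derive_exp c) x) as [c [H1 H2]].
  { now rewrite Rminus_0_r. }
  rewrite exp_0, !Rminus_0_r in *. rewrite H1, Rabs_mult.
  apply Rmult_le_compat_r; [apply Rabs_pos|].
  rewrite (Rabs_pos_eq (exp c)) by (left; apply exp_pos).
  apply Rle_trans with (exp 1); [|apply exp_le_3].
  apply Rabs_le_between in H2. apply Rabs_le_between in Hx.
  assert (c <= 1) by (generalize (Rle_abs x); unfold Rabs in *; destruct Rcase_abs; lra).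
  destruct (Req_dec c 1); [subst; lra|]. left. apply exp_increasing. lra.
Qed.

(** The mean value theorem for exp t - t turns the first-order bound on exp into a second-order one;
    [sin_sub_id_bound] is obtained from [cos_sub_1_bound] in the same way. *)
Lemma exp_taylor_1_bound (x : R) : Rabs x <= 1 -> Rabs (exp x - 1 - x) <= 3 * Rabs x ^ 2.
Proof.
  intros Hx.
  destruct (MVT_cor4 (fun t => exp t - t) (fun t => exp t - 1) 0 1) with (b := x) as [c [H1 H2]].
  { intros c _. auto_derive; [easy|ring]. }
  { now rewrite Rminus_0_r. }
  rewrite exp_0, !Rminus_0_r in *.
  replace (exp x - 1 - x) with ((exp c - 1) * x) by lra. rewrite Rabs_mult.
  assert (H := exp_sub_1_bound c (Rle_trans _ _ _ H2 Hx)).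
  generalize (Rabs_pos x) (Rabs_pos c). intros. simpl. rewrite Rmult_1_r, <- Rmult_assoc.
  apply Rmult_le_compat_r; [easy|]. lra.
Qed.

Lemma Rabs_sin_le (y : R) : Rabs (sin y) <= Rabs y.
Proof.
  destruct (MVT_cor4 sin cos 0 (Rabs y) (fun c _ => is_derive_sin c) y) as [c [H1 H2]].
  { rewrite Rminus_0_r; lra. }
  rewrite sin_0, !Rminus_0_r in *. rewrite H1, Rabs_mult.
  assert (Rabs (cos c) <= 1) by (apply Rabs_le; generalize (COS_bound c); lra).
  generalize (Rabs_pos y); nra.
Qed.

Lemma cos_sub_1_bound (y : R) : Rabs (cos y - 1) <= Rabs y ^ 2.
Proof.
  destruct (MVT_cor4 cos (fun t => - sin t) 0 (Rabs y) (fun c _ => is_derive_cos c) y) as [c [H1 H2]].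
  { rewrite Rminus_0_r; lra. }
  rewrite cos_0, !Rminus_0_r in *. rewrite H1, Rabs_mult, Rabs_Ropp.
  assert (H := Rabs_sin_le c). generalize (Rabs_pos y); nra.
Qed.

Lemma sin_sub_id_bound (y : R) : Rabs y <= 1 -> Rabs (sin y - y) <= Rabs y ^ 2.
Proof.
  intros Hy.
  destruct (MVT_cor4 (fun t => sin t - t) (fun t => cos t - 1) 0 1) with (b := y) as [c [H1 H2]].
  { intros c _. auto_derive; [easy|ring]. }
  { now rewrite Rminus_0_r. }
  rewrite sin_0, !Rminus_0_r in *. rewrite H1, Rabs_mult.
  assert (H := cos_sub_1_bound c). generalize (Rabs_pos y) (Rabs_pos c); simpl in *. nra.
Qed.

Lemma cexp_taylor_1_bound (h : C) :
  Cmod h <= 1 -> Cmod (cexp h - 1 - h) <= 20 * Cmod h ^ 2.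
Proof.
  destruct h as [x y]. intros Hh.
  assert (Hx : Rabs x <= Cmod (x, y)) by exact (re_le_Cmod (x, y)).
  assert (Hy : Rabs y <= Cmod (x, y)) by exact (Im_le_Cmod (x, y)).
  set (m := Cmod (x, y)) in *.
  assert (Hx1 : Rabs x <= 1) by lra. assert (Hy1 : Rabs y <= 1) by lra.
  (* Each component is split so that every summand falls under one of the four real bounds; each
     component is then at most 7 m^2. *)
  replace (cexp (x, y) - 1 - (x, y))%C
    with ((exp x * (cos y - 1) + (exp x - 1 - x), exp x * (sin y - y) + y * (exp x - 1)) : C).
  2:{ unfold cexp, proj, modulus, arg, Cminus, Cplus, Copp, RtoC; simpl. f_equal; ring. }
  eapply Rle_trans; [apply Cmod_le_Rabs|].
  assert (He : Rabs (exp x) <= 3 + 1).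
  { replace (exp x) with ((exp x - 1) + 1) by ring.
    eapply Rle_trans; [apply Rabs_triang|]. rewrite Rabs_R1.
    generalize (exp_sub_1_bound x Hx1); lra. }
  assert (B1 := exp_sub_1_bound x Hx1). assert (B2 := exp_taylor_1_bound x Hx1).
  assert (B3 := cos_sub_1_bound y). assert (B4 := sin_sub_id_bound y Hy1).
  assert (Sx : Rabs x ^ 2 <= m ^ 2) by (apply pow_incr; split; [apply Rabs_pos|lra]).
  assert (Sy : Rabs y ^ 2 <= m ^ 2) by (apply pow_incr; split; [apply Rabs_pos|lra]).
  assert (T1 : Rabs (exp x * (cos y - 1)) <= 4 * m ^ 2).
  { rewrite Rabs_mult. apply Rmult_le_compat; try apply Rabs_pos; lra. }
  assert (T2 : Rabs (exp x * (sin y - y)) <= 4 * m ^ 2).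
  { rewrite Rabs_mult. apply Rmult_le_compat; try apply Rabs_pos; lra. }
  assert (T3 : Rabs (y * (exp x - 1)) <= m * (3 * m)).
  { rewrite Rabs_mult. apply Rmult_le_compat; try apply Rabs_pos; lra. }
  generalize (Rabs_triang (exp x * (cos y - 1)) (exp x - 1 - x))
    (Rabs_triang (exp x * (sin y - y)) (y * (exp x - 1))). simpl in *. nra.
Qed.

Lemma cdiff_cexp (z : C) : cdiff cexp z.
Proof.
  apply cdiff_eps. exists (cexp z). intros eps Heps.
  assert (Hm : 0 < Cmod (cexp z)) by (rewrite Cmod_cexp; apply exp_pos).
  exists (Rmin 1 (eps / (20 * Cmod (cexp z)))). split.
  - apply Rmin_pos; [lra|]. apply Rdiv_lt_0_compat; lra.
  - intros w Hw.
    assert (H1 := Rlt_le_trans _ _ _ Hw (Rmin_l _ _)).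
    assert (H2 := Rlt_le_trans _ _ _ Hw (Rmin_r _ _)).
    set (h := (w - z)%C) in *.
    replace w with (z + h)%C by (unfold h; ring).
    replace (cexp (z + h) - cexp z - cexp z * h)%C with (cexp z * (cexp h - 1 - h))%C
      by (rewrite cexp_plus; ring).
    rewrite Cmod_mult.
    assert (B := cexp_taylor_1_bound h (Rlt_le _ _ H1)).
    apply Rmult_lt_compat_r with (r := 20 * Cmod (cexp z)) in H2; [|lra].
    replace (eps / (20 * Cmod (cexp z)) * (20 * Cmod (cexp z))) with eps in H2 by (field; lra).
    apply Rle_trans with (Cmod (cexp z) * (20 * Cmod h ^ 2)).
    + apply Rmult_le_compat_l; lra.
    + generalize (Cmod_ge_0 h). simpl. nra.
Qed.

(** * Goursat's theorem and the maximum principle on rectangles *)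

Definition in_rect (a b c d : R) (z : C) : Prop :=
  a <= fst z <= b /\ c <= snd z <= d.

Definition on_frame (a b c d : R) (z : C) : Prop :=
  in_rect a b c d z /\ (fst z = a \/ fst z = b \/ snd z = c \/ snd z = d).

(* The imaginary part of the contour integral of g along the counterclockwise
   boundary of [a, b] x [c, d]; opposite sides are paired so that the integrands
   are constant when g is affine. *)
Definition frame_int (g : C -> C) (a b c d : R) : R :=
  RInt (fun x => Im (g (x, c)) - Im (g (x, d))) a b +
  RInt (fun y => Re (g (b, y)) - Re (g (a, y))) c d.

Lemma ccont_Im_horizontal (g : C -> C) (x y : R) :
  ccont g (x, y) -> continuous (fun t => Im (g (t, y))) x.
Proof.
  intros H. apply filterlim_locally. intros eps.
  destruct (H eps (cond_pos eps)) as [d [Hd H']].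
  exists (mkposreal d Hd). intros t Ht.
  change (Rabs (Im (g (t, y)) - Im (g (x, y))) < eps).
  eapply Rle_lt_trans; [|apply (H' (t, y))].
  - apply (Im_le_Cmod (g (t, y) - g (x, y))).
  - eapply Rle_lt_trans; [apply Cmod_le_Rabs|]. simpl.
    replace (y + - y) with 0 by ring. rewrite Rabs_R0, Rplus_0_r. exact Ht.
Qed.

Lemma ccont_Re_vertical (g : C -> C) (x y : R) :
  ccont g (x, y) -> continuous (fun t => Re (g (x, t))) y.
Proof.
  intros H. apply filterlim_locally. intros eps.
  destruct (H eps (cond_pos eps)) as [d [Hd H']].
  exists (mkposreal d Hd). intros t Ht.
  change (Rabs (Re (g (x, t)) - Re (g (x, y))) < eps).
  eapply Rle_lt_trans; [|apply (H' (x, t))].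
  - apply (re_le_Cmod (g (x, t) - g (x, y))).
  - eapply Rle_lt_trans; [apply Cmod_le_Rabs|]. simpl.
    replace (x + - x) with 0 by ring. rewrite Rabs_R0, Rplus_0_l. exact Ht.
Qed.

Lemma ex_RInt_Im_horizontal (g : C -> C) (a b y : R) : a <= b ->
  (forall x, a <= x <= b -> ccont g (x, y)) -> ex_RInt (fun x => Im (g (x, y))) a b.
Proof.
  intros Hab H. apply (ex_RInt_continuous (V := R_CompleteNormedModule)).
  rewrite Rmin_left, Rmax_right by easy.
  intros z Hz. now apply ccont_Im_horizontal, H.
Qed.

Lemma ex_RInt_Re_vertical (g : C -> C) (c d x : R) : c <= d ->
  (forall y, c <= y <= d -> ccont g (x, y)) -> ex_RInt (fun y => Re (g (x, y))) c d.
Proof.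
  intros Hab H. apply (ex_RInt_continuous (V := R_CompleteNormedModule)).
  rewrite Rmin_left, Rmax_right by easy.
  intros z Hz. now apply ccont_Re_vertical, H.
Qed.

Lemma frame_continuous_sides (a b c d : R) (g : C -> C) : a <= b -> c <= d ->
  (forall z, on_frame a b c d z -> ccont g z) ->
  (forall x, a <= x <= b -> ccont g (x, c)) /\
  (forall x, a <= x <= b -> ccont g (x, d)) /\
  (forall y, c <= y <= d -> ccont g (a, y)) /\
  (forall y, c <= y <= d -> ccont g (b, y)).
Proof.
  intros Hab Hcd H. repeat split; intros t Ht; apply H; unfold on_frame, in_rect; simpl; lra.
Qed.

Lemma ex_RInt_frame (a b c d : R) (g : C -> C) : a <= b -> c <= d ->
  (forall z, on_frame a b c d z -> ccont g z) ->
  ex_RInt (fun x => Im (g (x, c)) - Im (g (x, d))) a b /\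
  ex_RInt (fun y => Re (g (b, y)) - Re (g (a, y))) c d.
Proof.
  intros Hab Hcd H. apply frame_continuous_sides in H; [|easy..]. destruct H as (H1 & H2 & H3 & H4).
  split; apply (ex_RInt_minus (V := R_NormedModule));
    auto using ex_RInt_Im_horizontal, ex_RInt_Re_vertical.
Qed.

Lemma frame_int_plus (a b c d : R) (g h : C -> C) : a <= b -> c <= d ->
  (forall z, on_frame a b c d z -> ccont g z) ->
  (forall z, on_frame a b c d z -> ccont h z) ->
  frame_int (fun z => g z + h z)%C a b c d = frame_int g a b c d + frame_int h a b c d.
Proof.
  intros Hab Hcd Hg Hh. apply ex_RInt_frame in Hg, Hh; [|easy..]. unfold frame_int.
  rewrite (RInt_ext _ (fun x => (Im (g (x, c)) - Im (g (x, d))) + (Im (h (x, c)) - Im (h (x, d)))))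
    by (intros; unfold Re, Im, Cplus; simpl; ring).
  rewrite (RInt_ext (fun y => Re (g (b, y) + h (b, y))%C - Re (g (a, y) + h (a, y))%C)
    (fun y => (Re (g (b, y)) - Re (g (a, y))) + (Re (h (b, y)) - Re (h (a, y)))))
    by (intros; unfold Re, Im, Cplus; simpl; ring).
  rewrite (RInt_plus (V := R_CompleteNormedModule)) by tauto.
  rewrite (RInt_plus (V := R_CompleteNormedModule)) by tauto.
  unfold plus; simpl. ring.
Qed.

(* The intended k1, k2 are the constant values of the two integrands for an
   affine approximation of g. *)
Lemma frame_int_approx (a b c d : R) (g : C -> C) (k1 k2 e : R) : a <= b -> c <= d ->
  (forall z, on_frame a b c d z -> ccont g z) ->
  (forall x, a <= x <= b -> Rabs (Im (g (x, c)) - Im (g (x, d)) - k1) <= e) ->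
  (forall y, c <= y <= d -> Rabs (Re (g (b, y)) - Re (g (a, y)) - k2) <= e) ->
  Rabs (frame_int g a b c d - (b - a) * k1 - (d - c) * k2) <= e * (b - a + (d - c)).
Proof.
  intros Hab Hcd Hg H1 H2. apply ex_RInt_frame in Hg; [|easy..]. unfold frame_int.
  assert (E : forall (f : R -> R) k u v, ex_RInt f u v ->
    RInt (fun x => f x - k) u v = RInt f u v - (v - u) * k).
  { intros f k u v Hf.
    rewrite (RInt_minus (V := R_CompleteNormedModule) f (fun _ => k)), RInt_const;
      [reflexivity|easy|apply (ex_RInt_const (V := R_NormedModule))]. }
  assert (X : forall (f : R -> R) k u v, ex_RInt f u v -> ex_RInt (fun x => f x - k) u v).
  { intros f k u v Hf.
    apply (ex_RInt_minus (V := R_NormedModule) f (fun _ => k));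
      [easy|apply (ex_RInt_const (V := R_NormedModule))]. }
  assert (B1 := abs_RInt_le_const _ a b e Hab (X _ k1 _ _ (proj1 Hg)) H1).
  assert (B2 := abs_RInt_le_const _ c d e Hcd (X _ k2 _ _ (proj2 Hg)) H2).
  rewrite E in B1, B2 by tauto.
  apply Rabs_le_between in B1. apply Rabs_le_between in B2. apply Rabs_le. lra.
Qed.

Lemma frame_int_bound (a b c d : R) (g : C -> C) (K : R) : a <= b -> c <= d ->
  (forall z, on_frame a b c d z -> ccont g z) ->
  (forall z, on_frame a b c d z -> Cmod (g z) <= K) ->
  Rabs (frame_int g a b c d) <= 2 * K * (b - a + (d - c)).
Proof.
  intros Hab Hcd Hg HK.
  assert (B : forall u v, on_frame a b c d u -> on_frame a b c d v ->
    Rabs (Im (g u) - Im (g v) - 0) <= 2 * K /\ Rabs (Re (g u) - Re (g v) - 0) <= 2 * K).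
  { intros u v Hu Hv. apply HK in Hu, Hv.
    assert (H1 := Im_le_Cmod (g u)). assert (H2 := Im_le_Cmod (g v)).
    assert (H3 := re_le_Cmod (g u)). assert (H4 := re_le_Cmod (g v)).
    apply Rabs_le_between in H1, H2, H3, H4. split; apply Rabs_le; lra. }
  assert (H := frame_int_approx a b c d g 0 0 (2 * K) Hab Hcd Hg).
  rewrite !Rmult_0_r, !Rminus_0_r in H. apply H.
  - intros x Hx. apply B; unfold on_frame, in_rect; simpl; lra.
  - intros y Hy. apply B; unfold on_frame, in_rect; simpl; lra.
Qed.

Lemma frame_int_split_x (g : C -> C) (a m b c d : R) :
  a <= m <= b -> c <= d ->
  (forall z, on_frame a m c d z -> ccont g z) ->
  (forall z, on_frame m b c d z -> ccont g z) ->
  frame_int g a b c d = frame_int g a m c d + frame_int g m b c d.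
Proof.
  intros Hm Hcd H1 H2.
  assert (I1 := ex_RInt_frame a m c d g (proj1 Hm) Hcd H1).
  assert (I2 := ex_RInt_frame m b c d g (proj2 Hm) Hcd H2).
  unfold frame_int.
  rewrite <- (RInt_Chasles _ a m b) by tauto.
  rewrite (RInt_ext (fun y => Re (g (b, y)) - Re (g (a, y)))
    (fun y => (Re (g (m, y)) - Re (g (a, y))) + (Re (g (b, y)) - Re (g (m, y)))))
    by (intros; simpl; ring).
  rewrite (RInt_plus (V := R_CompleteNormedModule)) by tauto.
  unfold plus; simpl. ring.
Qed.

Lemma frame_int_split_y (g : C -> C) (a b c m d : R) :
  a <= b -> c <= m <= d ->
  (forall z, on_frame a b c m z -> ccont g z) ->
  (forall z, on_frame a b m d z -> ccont g z) ->
  frame_int g a b c d = frame_int g a b c m + frame_int g a b m d.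
Proof.
  intros Hab Hm H1 H2.
  assert (I1 := ex_RInt_frame a b c m g Hab (proj1 Hm) H1).
  assert (I2 := ex_RInt_frame a b m d g Hab (proj2 Hm) H2).
  unfold frame_int.
  rewrite <- (RInt_Chasles _ c m d) by tauto.
  rewrite (RInt_ext (fun x => Im (g (x, c)) - Im (g (x, d)))
    (fun x => (Im (g (x, c)) - Im (g (x, m))) + (Im (g (x, m)) - Im (g (x, d)))))
    by (intros; simpl; ring).
  rewrite (RInt_plus (V := R_CompleteNormedModule)) by tauto.
  unfold plus; simpl. ring.
Qed.

(** Left endpoints increase and right endpoints decrease, so every right endpoint bounds all left
    endpoints; u is the supremum of the latter. *)
Lemma nested_dyadic_intervals (x : nat -> R) (W : R) : 0 <= W ->
  (forall n, x n <= x (S n) /\ x (S n) + W / 2 ^ S n <= x n + W / 2 ^ n) ->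
  exists u, forall n, x n <= u <= x n + W / 2 ^ n.
Proof.
  intros HW H.
  assert (HP : forall n, 0 <= W / 2 ^ n).
  { intros n. apply Rdiv_le_0_compat; [easy|apply pow_lt; lra]. }
  assert (Hk : forall n k, x n <= x (n + k)%nat /\
    x (n + k)%nat + W / 2 ^ (n + k) <= x n + W / 2 ^ n).
  { intros n. induction k as [|k IH].
    - rewrite Nat.add_0_r. lra.
    - rewrite Nat.add_succ_r. specialize (H (n + k)%nat). lra. }
  assert (B : forall n m, x n <= x m + W / 2 ^ m).
  { intros n m. destruct (Nat.le_ge_cases n m) as [L|L].
    - destruct (Nat.le_exists_sub _ _ L) as [k [-> _]]. rewrite Nat.add_comm.
      generalize (Hk n k) (HP (n + k)%nat). lra.
    - destruct (Nat.le_exists_sub _ _ L) as [k [-> _]]. rewrite Nat.add_comm.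
      generalize (Hk m k) (HP (m + k)%nat). lra. }
  destruct (completeness (fun t => exists n, t = x n)) as [u [Hu1 Hu2]].
  - exists (x 0%nat + W / 2 ^ 0). intros t [n ->]. apply B.
  - exists (x 0%nat), 0%nat. reflexivity.
  - exists u. intros n. split.
    + apply Hu1. now exists n.
    + apply Hu2. intros t [m ->]. apply B.
Qed.

Lemma rectangle_bisection (P : R -> R -> R -> R -> Prop) (a b c d : R) :
  a <= b -> c <= d -> P a b c d ->
  (forall a b c d, a <= b -> c <= d -> P a b c d ->
     P a ((a + b) / 2) c ((c + d) / 2) \/ P ((a + b) / 2) b c ((c + d) / 2) \/
     P a ((a + b) / 2) ((c + d) / 2) d \/ P ((a + b) / 2) b ((c + d) / 2) d) ->
  exists u v, forall n, exists x y,
    x <= u <= x + (b - a) / 2 ^ n /\ y <= v <= y + (d - c) / 2 ^ n /\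
    P x (x + (b - a) / 2 ^ n) y (y + (d - c) / 2 ^ n).
Proof.
  intros Hab Hcd HP Hstep.
  set (W := b - a). set (H := d - c).
  (* The side lengths at stage n are known in advance, so a stage is recorded by its lower left
     corner alone. *)
  set (Q := fun (n : nat) (p : R * R) =>
    P (fst p) (fst p + W / 2 ^ n) (snd p) (snd p + H / 2 ^ n)).
  assert (HW : forall n, 0 <= W / 2 ^ n).
  { intros n. apply Rdiv_le_0_compat; [unfold W; lra|apply pow_lt; lra]. }
  assert (HH : forall n, 0 <= H / 2 ^ n).
  { intros n. apply Rdiv_le_0_compat; [unfold H; lra|apply pow_lt; lra]. }
  assert (half : forall V n, V / 2 ^ S n = V / 2 ^ n / 2).
  { intros V n. simpl. field. apply pow_nonzero. lra. }
  assert (next : forall n p, Q n p -> exists q, Q (S n) q /\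
    (fst p <= fst q /\ fst q + W / 2 ^ S n <= fst p + W / 2 ^ n) /\
    (snd p <= snd q /\ snd q + H / 2 ^ S n <= snd p + H / 2 ^ n)).
  { intros n [x y] Hp. unfold Q in *; simpl fst in *; simpl snd in *.
    rewrite !half. generalize (HW n) (HH n). intros Hw Hh.
    set (w := W / 2 ^ n) in *. set (h := H / 2 ^ n) in *.
    apply Hstep in Hp; [|lra|lra].
    replace ((x + (x + w)) / 2) with (x + w / 2) in Hp by field.
    replace ((y + (y + h)) / 2) with (y + h / 2) in Hp by field.
    destruct Hp as [Hp|[Hp|[Hp|Hp]]];
      [exists (x, y)|exists (x + w / 2, y)|exists (x, y + h / 2)|exists (x + w / 2, y + h / 2)];
      simpl; (split; [|lra]);
      repeat (replace (x + w / 2 + w / 2) with (x + w) by field);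
      repeat (replace (y + h / 2 + h / 2) with (y + h) by field); exact Hp. }
  assert (start : Q 0%nat (a, c)).
  { unfold Q, W, H; simpl. rewrite !Rdiv_1_r.
    replace (a + (b - a)) with b by ring. now replace (c + (d - c)) with d by ring. }
  (* [next] only asserts existence, so the corners are chosen by indefinite description, each
     carried along with its proof of [Q]. *)
  set (s := nat_rect (fun n => {p : R * R | Q n p}) (exist _ (a, c) start)
    (fun n p => let E := constructive_indefinite_description _ (next n (proj1_sig p) (proj2_sig p)) in
       exist _ (proj1_sig E) (proj1 (proj2_sig E)))).
  assert (Hs : forall n,
    (fst (proj1_sig (s n)) <= fst (proj1_sig (s (S n))) /\
     fst (proj1_sig (s (S n))) + W / 2 ^ S n <= fst (proj1_sig (s n)) + W / 2 ^ n) /\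
    (snd (proj1_sig (s n)) <= snd (proj1_sig (s (S n))) /\
     snd (proj1_sig (s (S n))) + H / 2 ^ S n <= snd (proj1_sig (s n)) + H / 2 ^ n)).
  { intros n. simpl s. cbv zeta.
    exact (proj2 (proj2_sig (constructive_indefinite_description _ (next n (proj1_sig (s n)) (proj2_sig (s n)))))). }
  destruct (nested_dyadic_intervals (fun n => fst (proj1_sig (s n))) W) as [u Hu];
    [unfold W; lra|intros n; apply Hs|].
  destruct (nested_dyadic_intervals (fun n => snd (proj1_sig (s n))) H) as [v Hv];
    [unfold H; lra|intros n; apply Hs|].
  exists u, v. intros n. exists (fst (proj1_sig (s n))), (snd (proj1_sig (s n))).
  split; [apply Hu|split; [apply Hv|]]. exact (proj2_sig (s n)).
Qed.

Lemma in_rect_sub (a b c d a' b' c' d' : R) (z : C) :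
  a <= a' -> b' <= b -> c <= c' -> d' <= d -> in_rect a' b' c' d' z -> in_rect a b c d z.
Proof. unfold in_rect. lra. Qed.

Lemma Rabs_minus_le_of_between (x u v l : R) :
  l <= x <= l + v -> l <= u <= l + v -> Rabs (x - u) <= v.
Proof. intros. apply Rabs_le. lra. Qed.

Lemma pow2_unbounded (x : R) : exists n, x < 2 ^ n.
Proof.
  destruct (Pow_x_infinity 2) with (b := x + 1) as [n Hn].
  - rewrite Rabs_pos_eq; lra.
  - exists n. specialize (Hn n (le_n n)).
    rewrite Rabs_pos_eq in Hn by (apply pow_le; lra). lra.
Qed.

Lemma goursat (g : C -> C) (a b c d : R) : a < b -> c < d ->
  (forall z, in_rect a b c d z -> cdiff g z) -> frame_int g a b c d = 0.
Proof.
  intros Hab Hcd Hg. apply NNPP. intros HJ.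
  assert (HJ' : 0 < Rabs (frame_int g a b c d)) by now apply Rabs_pos_lt.
  (* Some quarter keeps at least a fourth of the integral, and (width + height)^2 is divided by
     exactly four, so the ratio [kappa] is inherited as a lower bound. *)
  set (kappa := Rabs (frame_int g a b c d) / (b - a + (d - c)) ^ 2).
  assert (Hk : 0 < kappa).
  { apply Rdiv_lt_0_compat; [easy|]. apply pow_lt. lra. }
  set (P := fun a' b' c' d' => a <= a' /\ b' <= b /\ c <= c' /\ d' <= d /\
    kappa * (b' - a' + (d' - c')) ^ 2 <= Rabs (frame_int g a' b' c' d')).
  assert (Hcont : forall a' b' c' d' z, a <= a' -> b' <= b -> c <= c' -> d' <= d ->
    on_frame a' b' c' d' z -> ccont g z).
  { intros a' b' c' d' z Ha Hb Hc Hd [Hz _].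
    exact (cdiff_ccont g z (Hg z (in_rect_sub _ _ _ _ _ _ _ _ z Ha Hb Hc Hd Hz))). }
  destruct (rectangle_bisection P a b c d) as (u & v & Huv).
  - lra.
  - lra.
  - unfold P. repeat split; try lra. unfold kappa. right. field. lra.
  - intros a' b' c' d' Hab' Hcd' (Ha & Hb & Hc & Hd & HP).
    set (m := (a' + b') / 2). set (n := (c' + d') / 2).
    assert (Hm : a' <= m <= b') by (unfold m; lra).
    assert (Hn : c' <= n <= d') by (unfold n; lra).
    apply NNPP. intros N.
    rewrite (frame_int_split_x g a' m b' c' d') in HP;
      [|easy|easy|intros z; apply Hcont; lra..].
    rewrite (frame_int_split_y g a' m c' n d') in HP;
      [|easy|easy|intros z; apply Hcont; lra..].
    rewrite (frame_int_split_y g m b' c' n d') in HP;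
      [|easy|easy|intros z; apply Hcont; lra..].
    assert (S : forall x1 x2 y1 y2, x2 - x1 = (b' - a') / 2 -> y2 - y1 = (d' - c') / 2 ->
      a <= x1 -> x2 <= b -> c <= y1 -> y2 <= d -> ~ P x1 x2 y1 y2 ->
      Rabs (frame_int g x1 x2 y1 y2) < kappa * (b' - a' + (d' - c')) ^ 2 / 4).
    { intros x1 x2 y1 y2 Hx Hy ? ? ? ? HN. apply Rnot_le_lt. intros L. apply HN.
      repeat split; try easy. rewrite Hx, Hy. eapply Rle_trans; [|exact L]. right. field. }
    assert (Hm1 : m - a' = (b' - a') / 2) by (unfold m; field).
    assert (Hm2 : b' - m = (b' - a') / 2) by (unfold m; field).
    assert (Hn1 : n - c' = (d' - c') / 2) by (unfold n; field).
    assert (Hn2 : d' - n = (d' - c') / 2) by (unfold n; field).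
    assert (S1 := S a' m c' n Hm1 Hn1 ltac:(lra) ltac:(lra) ltac:(lra) ltac:(lra) ltac:(tauto)).
    assert (S2 := S m b' c' n Hm2 Hn1 ltac:(lra) ltac:(lra) ltac:(lra) ltac:(lra) ltac:(tauto)).
    assert (S3 := S a' m n d' Hm1 Hn2 ltac:(lra) ltac:(lra) ltac:(lra) ltac:(lra) ltac:(tauto)).
    assert (S4 := S m b' n d' Hm2 Hn2 ltac:(lra) ltac:(lra) ltac:(lra) ltac:(lra) ltac:(tauto)).
    clear - HP S1 S2 S3 S4.
    generalize (Rabs_triang (frame_int g a' m c' n + frame_int g a' m n d')
      (frame_int g m b' c' n + frame_int g m b' n d'))
      (Rabs_triang (frame_int g a' m c' n) (frame_int g a' m n d'))
      (Rabs_triang (frame_int g m b' c' n) (frame_int g m b' n d')). lra.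
  - assert (Huv0 : in_rect a b c d (u, v)).
    { destruct (Huv 0%nat) as (x & y & Hu & Hv & Ha & Hb & Hc & Hd & _).
      unfold in_rect; simpl fst; simpl snd; lra. }
    destruct (proj1 (cdiff_eps g (u, v)) (Hg _ Huv0)) as [l Hl].
    destruct (Hl (kappa / 8)) as [delta [Hdelta Happ]]; [lra|].
    destruct (pow2_unbounded ((b - a + (d - c)) / delta)) as [n Hn].
    assert (H2 : 0 < 2 ^ n) by (apply pow_lt; lra).
    destruct (Huv n) as (x & y & Hu & Hv & Ha & Hb & Hc & Hd & HP).
    assert (Hw : 0 < (b - a) / 2 ^ n) by (apply Rdiv_lt_0_compat; lra).
    assert (Hh : 0 < (d - c) / 2 ^ n) by (apply Rdiv_lt_0_compat; lra).
    assert (Hwh : (b - a) / 2 ^ n + (d - c) / 2 ^ n < delta).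
    { apply Rmult_lt_compat_r with (r := delta) in Hn; [|easy].
      unfold Rdiv in Hn at 1. rewrite Rmult_assoc, Rinv_l, Rmult_1_r in Hn by lra.
      rewrite <- Rdiv_plus_distr. apply Rmult_lt_reg_r with (2 ^ n); [easy|].
      unfold Rdiv. rewrite Rmult_assoc, Rinv_l by lra. lra. }
    set (w := (b - a) / 2 ^ n) in *. set (h := (d - c) / 2 ^ n) in *.
    assert (Hnear : forall z, in_rect x (x + w) y (y + h) z ->
      Cmod (g z - g (u, v) - l * (z - (u, v))) <= kappa / 8 * (w + h)).
    { intros [z1 z2] [Hz1 Hz2]. simpl in Hz1, Hz2.
      assert (B : Cmod ((z1, z2) - (u, v)) <= w + h).
      { eapply Rle_trans; [apply (Cmod_le_Rabs (z1 - u) (z2 - v))|].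
        apply Rplus_le_compat; eapply Rabs_minus_le_of_between; eassumption. }
      eapply Rle_trans; [apply Happ; lra|]. apply Rmult_le_compat_l; lra. }
    assert (Hdiff : forall z z', in_rect x (x + w) y (y + h) z -> in_rect x (x + w) y (y + h) z' ->
      Cmod (g z - g z' - l * (z - z')) <= kappa / 4 * (w + h)).
    { intros z z' Hz Hz'. apply Hnear in Hz, Hz'.
      replace (g z - g z' - l * (z - z'))%C
        with ((g z - g (u, v) - l * (z - (u, v))) - (g z' - g (u, v) - l * (z' - (u, v))))%C by ring.
      eapply Rle_trans; [apply Cmod_triangle_minus|]. lra. }
    (* For the affine part l z the paired integrands are the constants Im(- i h l) and Re(w l);
       their contributions - w h Re l and h w Re l cancel, leaving the remainder alone. *)
    assert (B := frame_int_approx x (x + w) y (y + h) g (- Re l * h) (Re l * w)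
      (kappa / 4 * (w + h))).
    replace (frame_int g x (x + w) y (y + h) - (x + w - x) * (- Re l * h) -
      (y + h - y) * (Re l * w)) with (frame_int g x (x + w) y (y + h)) in B by ring.
    replace (x + w - x) with w in * by ring. replace (y + h - y) with h in * by ring.
    assert (B' : Rabs (frame_int g x (x + w) y (y + h)) <= kappa / 4 * (w + h) * (w + h)).
    { apply B; clear B; [lra|lra|intros z; apply Hcont; lra| |].
      - intros t Ht. eapply Rle_trans; [|apply (Hdiff (t, y) (t, y + h))].
        + eapply Rle_trans; [|apply Im_le_Cmod]. right. f_equal.
          unfold Im, Re, Cminus, Cplus, Copp, Cmult; simpl. ring.
        + unfold in_rect; simpl; lra.
        + unfold in_rect; simpl; lra.
      - intros t Ht. eapply Rle_trans; [|apply (Hdiff (x + w, t) (x, t))].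
        + eapply Rle_trans; [|apply re_le_Cmod]. right. f_equal.
          unfold Im, Re, Cminus, Cplus, Copp, Cmult; simpl. ring.
        + unfold in_rect; simpl; lra.
        + unfold in_rect; simpl; lra. }
    assert (0 < (w + h) * (w + h)) by (apply Rmult_lt_0_compat; lra).
    simpl in HP. nra.
Qed.

(** Cutting out a square of half-side eta around p leaves four rectangles that avoid p, on which
    [goursat] applies; the square contributes at most 8 K eta. *)
Lemma goursat_removable (g : C -> C) (a b c d r K : R) (p : C) :
  a < fst p < b -> c < snd p < d -> 0 < r ->
  (forall z, in_rect a b c d z -> z <> p -> cdiff g z) ->
  (forall z, z <> p -> Cmod (z - p) < r -> Cmod (g z) <= K) ->
  frame_int g a b c d = 0.
Proof.
  destruct p as [p1 p2]. simpl fst; simpl snd. intros H1 H2 Hr Hg HK.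
  set (s := Rmin (r / 2) (Rmin (Rmin (p1 - a) (b - p1)) (Rmin (p2 - c) (d - p2)))).
  assert (Hs : 0 < s /\ s <= r / 2 /\ s <= p1 - a /\ s <= b - p1 /\ s <= p2 - c /\ s <= d - p2).
  { unfold s. repeat split.
    - repeat apply Rmin_pos; lra.
    - apply Rmin_l.
    - eapply Rle_trans; [apply Rmin_r|]. eapply Rle_trans; [apply Rmin_l|]. apply Rmin_l.
    - eapply Rle_trans; [apply Rmin_r|]. eapply Rle_trans; [apply Rmin_l|]. apply Rmin_r.
    - eapply Rle_trans; [apply Rmin_r|]. eapply Rle_trans; [apply Rmin_r|]. apply Rmin_l.
    - eapply Rle_trans; [apply Rmin_r|]. eapply Rle_trans; [apply Rmin_r|]. apply Rmin_r. }
  clearbody s.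
  assert (HJ : forall eta, 0 < eta < s -> Rabs (frame_int g a b c d) <= 2 * K * (4 * eta)).
  { intros e He.
    assert (Hc : forall a' b' c' d' z, a <= a' -> b' <= b -> c <= c' -> d' <= d ->
      (p1 < a' \/ b' < p1 \/ p2 < c' \/ d' < p2 \/ (a' < p1 < b' /\ c' < p2 < d')) ->
      on_frame a' b' c' d' z -> ccont g z).
    { intros a' b' c' d' z Ha Hb Hc Hd Hout [Hz Hf].
      apply cdiff_ccont, Hg.
      - now apply (in_rect_sub a b c d a' b' c' d').
      - intros ->. unfold in_rect in Hz. simpl in *. lra. }
    assert (H0 : forall a' b' c' d', a' < b' -> c' < d' -> a <= a' -> b' <= b -> c <= c' -> d' <= d ->
      (p1 < a' \/ b' < p1 \/ p2 < c' \/ d' < p2) -> frame_int g a' b' c' d' = 0).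
    { intros a' b' c' d' Hab Hcd Ha Hb Hc' Hd Hout. apply goursat; [easy|easy|].
      intros z Hz. apply Hg.
      - now apply (in_rect_sub a b c d a' b' c' d').
      - intros ->. unfold in_rect in Hz. simpl in *. lra. }
    rewrite (frame_int_split_x g a (p1 - e) b c d);
      [|lra|lra|intros z; apply Hc; lra..].
    rewrite (H0 a (p1 - e)) by lra.
    rewrite (frame_int_split_x g (p1 - e) (p1 + e) b c d);
      [|lra|lra|intros z; apply Hc; lra..].
    rewrite (H0 (p1 + e) b) by lra.
    rewrite (frame_int_split_y g (p1 - e) (p1 + e) c (p2 - e) d);
      [|lra|lra|intros z; apply Hc; lra..].
    rewrite (H0 _ _ c (p2 - e)) by lra.
    rewrite (frame_int_split_y g (p1 - e) (p1 + e) (p2 - e) (p2 + e) d);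
      [|lra|lra|intros z; apply Hc; lra..].
    rewrite (H0 _ _ (p2 + e) d) by lra.
    rewrite !Rplus_0_l, !Rplus_0_r.
    eapply Rle_trans; [apply (frame_int_bound _ _ _ _ g K)|].
    - lra.
    - lra.
    - intros z. apply Hc; lra.
    - intros [z1 z2] [[Hz1 Hz2] Hf]. simpl in *. apply HK.
      + intros E. injection E as -> ->. lra.
      + eapply Rle_lt_trans; [apply (Cmod_le_Rabs (z1 - p1) (z2 - p2))|].
        assert (Rabs (z1 - p1) <= e) by (apply Rabs_le; lra).
        assert (Rabs (z2 - p2) <= e) by (apply Rabs_le; lra). lra.
    - right. ring. }
  apply NNPP. intros HJ0. apply Rabs_pos_lt in HJ0.
  set (J := Rabs (frame_int g a b c d)) in *.
  assert (HK0 : 0 < K) by (specialize (HJ (s / 2)); nra).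
  set (e := Rmin (s / 2) (J / (16 * K))).
  assert (He : 0 < e).
  { apply Rmin_pos; [lra|]. apply Rdiv_lt_0_compat; lra. }
  assert (He1 : e <= s / 2) by apply Rmin_l.
  assert (He2 : e <= J / (16 * K)) by apply Rmin_r.
  specialize (HJ e ltac:(lra)).
  apply Rmult_le_compat_r with (r := 16 * K) in He2; [|lra].
  unfold Rdiv in He2. rewrite Rmult_assoc, Rinv_l, Rmult_1_r in He2 by lra. lra.
Qed.

Lemma cdiff_inv_shift (p z : C) : z <> p -> cdiff (fun w => / (w - p))%C z.
Proof.
  intros Hz. apply (cdiff_comp Cinv (fun w => w - p)%C).
  - apply cdiff_inv. intros E. apply Hz.
    replace z with (z - p + p)%C by ring. rewrite E. ring.
  - apply (cdiff_minus (fun w => w)); [apply cdiff_id|apply cdiff_const].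
Qed.

(** The full contour integral is 2 pi i, but its sign is enough: since p lies strictly between
    opposite sides, both paired integrands are positive sums. *)
Lemma frame_int_inv_pos (a b c d : R) (p : C) :
  a < fst p < b -> c < snd p < d ->
  0 < frame_int (fun z => / (z - p))%C a b c d.
Proof.
  destruct p as [p1 p2]. simpl fst; simpl snd. intros H1 H2.
  assert (Hc : forall z, on_frame a b c d z -> ccont (fun z => / (z - (p1, p2)))%C z).
  { intros z [_ Hf]. apply cdiff_ccont, cdiff_inv_shift. intros ->. simpl in Hf. lra. }
  destruct (frame_continuous_sides a b c d _ ltac:(lra) ltac:(lra) Hc) as (S1 & S2 & S3 & S4).
  unfold frame_int. apply Rplus_lt_0_compat; apply RInt_gt_0; [lra| | |lra| |].
  - intros x Hx. unfold Im, Cinv, Cminus, Cplus, Copp; simpl.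
    assert (D1 : 0 < (x - p1) ^ 2 + (p2 - c) ^ 2)
      by (apply Rplus_le_lt_0_compat; [apply pow2_ge_0|apply pow_lt; lra]).
    assert (D2 : 0 < (x - p1) ^ 2 + (d - p2) ^ 2)
      by (apply Rplus_le_lt_0_compat; [apply pow2_ge_0|apply pow_lt; lra]).
    match goal with |- 0 < ?t =>
      replace t with ((p2 - c) / ((x - p1) ^ 2 + (p2 - c) ^ 2) + (d - p2) / ((x - p1) ^ 2 + (d - p2) ^ 2))
        by (field; split; apply Rgt_not_eq; ring_simplify; ring_simplify in D1; ring_simplify in D2; lra) end.
    apply Rplus_lt_0_compat; apply Rdiv_lt_0_compat; lra.
  - intros x Hx. apply (continuous_minus (V := R_NormedModule));
      apply (ccont_Im_horizontal (fun z => / (z - (p1, p2)))%C); auto.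
  - intros y Hy. unfold Re, Cinv, Cminus, Cplus, Copp; simpl.
    assert (D1 : 0 < (b - p1) ^ 2 + (y - p2) ^ 2)
      by (apply Rplus_lt_le_0_compat; [apply pow_lt; lra|apply pow2_ge_0]).
    assert (D2 : 0 < (p1 - a) ^ 2 + (y - p2) ^ 2)
      by (apply Rplus_lt_le_0_compat; [apply pow_lt; lra|apply pow2_ge_0]).
    match goal with |- 0 < ?t =>
      replace t with ((b - p1) / ((b - p1) ^ 2 + (y - p2) ^ 2) + (p1 - a) / ((p1 - a) ^ 2 + (y - p2) ^ 2))
        by (field; split; apply Rgt_not_eq; ring_simplify; ring_simplify in D1; ring_simplify in D2; lra) end.
    apply Rplus_lt_0_compat; apply Rdiv_lt_0_compat; lra.
  - intros y Hy. apply (continuous_minus (V := R_NormedModule));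
      apply (ccont_Re_vertical (fun z => / (z - (p1, p2)))%C); auto.
Qed.

(** The quotient (F z - 1) / (z - p) is differentiable away from p and bounded near p, so its
    integral vanishes. Normalising F p to 1 gives a form of Cauchy's formula that involves imaginary
    parts only. *)
Lemma frame_int_Cauchy (F : C -> C) (a b c d : R) (p : C) :
  a < fst p < b -> c < snd p < d ->
  (forall z, in_rect a b c d z -> cdiff F z) -> F p = 1%C ->
  frame_int (fun z => F z * / (z - p))%C a b c d = frame_int (fun z => / (z - p))%C a b c d.
Proof.
  intros H1 H2 HF Hp.
  set (g := fun z => ((F z - 1) * / (z - p))%C).
  assert (Hpr : in_rect a b c d p) by (unfold in_rect; lra).
  assert (Hg : forall z, in_rect a b c d z -> z <> p -> cdiff g z).
  { intros z Hz Hzp. apply (cdiff_mult (fun z => F z - 1)%C (fun z => / (z - p))%C).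
    - apply (cdiff_minus F); [now apply HF|apply cdiff_const].
    - now apply cdiff_inv_shift. }
  assert (Hfr : forall z, on_frame a b c d z -> in_rect a b c d z /\ z <> p).
  { intros z [Hz Hf]. split; [easy|]. intros ->. lra. }
  assert (J0 : frame_int g a b c d = 0).
  { destruct (proj1 (cdiff_eps F p) (HF p Hpr)) as [l Hl].
    destruct (Hl 1 Rlt_0_1) as [r [Hr Happ]].
    apply (goursat_removable g a b c d r (Cmod l + 1) p H1 H2 Hr Hg).
    intros z Hzp Hz. specialize (Happ z Hz). rewrite Hp in Happ.
    assert (Hn : (z - p)%C <> 0).
    { intros E. apply Hzp. replace z with (z - p + p)%C by ring. rewrite E. ring. }
    assert (Hm : 0 < Cmod (z - p)) by now apply Cmod_gt_0.
    unfold g. rewrite Cmod_mult, Cmod_inv by easy.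
    apply Rmult_le_reg_r with (Cmod (z - p)); [easy|].
    rewrite Rmult_assoc, Rinv_l, Rmult_1_r by lra.
    replace (F z - 1)%C with ((F z - 1 - l * (z - p)) + l * (z - p))%C by ring.
    eapply Rle_trans; [apply Cmod_triangle|]. rewrite Cmod_mult. lra. }
  assert (E := frame_int_plus a b c d g (fun z => / (z - p))%C ltac:(lra) ltac:(lra)).
  rewrite J0, Rplus_0_l in E. rewrite <- E.
  - unfold frame_int. f_equal; apply RInt_ext; intros t _; unfold g; do 2 f_equal; ring.
  - intros z Hz. apply Hfr in Hz. apply cdiff_ccont, Hg; tauto.
  - intros z Hz. apply Hfr in Hz. apply cdiff_ccont, cdiff_inv_shift; tauto.
Qed.

(* Cauchy's formula bounds |F p| only up to a factor; applying it to all powers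
   of F removes the factor. *)
Lemma maximum_principle (F : C -> C) (a b c d K : R) :
  (forall z, in_rect a b c d z -> cdiff F z) ->
  (forall z, on_frame a b c d z -> Cmod (F z) <= K) ->
  forall z, in_rect a b c d z -> Cmod (F z) <= K.
Proof.
  intros HF HK p Hp.
  destruct (classic (on_frame a b c d p)) as [Hf|Hf]; [now apply HK|].
  destruct p as [p1 p2].
  assert (H1 : a < p1 < b /\ c < p2 < d).
  { unfold on_frame in Hf. destruct Hp as [Hp1 Hp2]. simpl in *.
    assert (p1 <> a /\ p1 <> b /\ p2 <> c /\ p2 <> d).
    { repeat split; intros E; apply Hf; unfold in_rect; simpl; tauto. } lra. }
  destruct H1 as [H1 H2]. set (p := (p1, p2) : C) in *.
  apply Rnot_lt_le. intros HL.
  assert (HK0 : 0 <= K).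
  { eapply Rle_trans; [apply Cmod_ge_0|apply (HK (a, p2))].
    unfold on_frame, in_rect; simpl; lra. }
  assert (Hp0 : F p <> 0) by (apply Cmod_gt_0; lra).
  set (r := Rmin (Rmin (p1 - a) (b - p1)) (Rmin (p2 - c) (d - p2))).
  assert (Hr : 0 < r /\ r <= p1 - a /\ r <= b - p1 /\ r <= p2 - c /\ r <= d - p2).
  { unfold r. repeat split.
    - repeat apply Rmin_pos; lra.
    - eapply Rle_trans; [apply Rmin_l|apply Rmin_l].
    - eapply Rle_trans; [apply Rmin_l|apply Rmin_r].
    - eapply Rle_trans; [apply Rmin_r|apply Rmin_l].
    - eapply Rle_trans; [apply Rmin_r|apply Rmin_r]. }
  assert (Hdist : forall z, on_frame a b c d z -> r <= Cmod (z - p)).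
  { intros [z1 z2] [[Hz1 Hz2] Hz]. simpl in *.
    assert (A1 := re_le_Cmod ((z1, z2) - p)). assert (A2 := Im_le_Cmod ((z1, z2) - p)).
    unfold p, Re, Im, Cminus, Cplus, Copp in A1, A2; simpl in A1, A2.
    assert (B1 := Rle_trans _ _ _ (Rle_abs _) A1).
    assert (B2 := Rle_trans _ _ _ (Rle_abs _) A2).
    rewrite <- Rabs_Ropp in A1, A2.
    assert (B3 := Rle_trans _ _ _ (Rle_abs _) A1).
    assert (B4 := Rle_trans _ _ _ (Rle_abs _) A2).
    unfold p, Cminus, Cplus, Copp; simpl. lra. }
  set (q := K / Cmod (F p)).
  assert (Hq : 0 <= q < 1).
  { split; [apply Rdiv_le_0_compat; lra|].
    apply Rmult_lt_reg_r with (Cmod (F p)); [lra|].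
    unfold q, Rdiv. rewrite Rmult_assoc, Rinv_l; lra. }
  (* [G n] is 1 at p and at most q^n in modulus on the frame, so the positive number [J], which does
     not depend on n, is bounded by a multiple of q^n. *)
  set (G := fun n z => ((/ F p * F z) ^ n)%C).
  assert (HG : forall n z, in_rect a b c d z -> cdiff (G n) z).
  { intros n z Hz. apply (cdiff_pow (fun z => / F p * F z)%C), (cdiff_mult (fun _ => / F p)%C F).
    - apply cdiff_const.
    - now apply HF. }
  set (J := frame_int (fun z => / (z - p))%C a b c d).
  assert (HJ0 : 0 < J) by now apply frame_int_inv_pos.
  assert (HJ : forall n, J <= 2 * (q ^ n * / r) * (b - a + (d - c))).
  { intros n.
    assert (E : frame_int (fun z => G n z * / (z - p))%C a b c d = J).
    { apply frame_int_Cauchy; [easy|easy|apply HG|].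
      unfold G. rewrite Cinv_l by easy. apply Cpow_1_l. }
    rewrite <- E. eapply Rle_trans; [apply Rle_abs|]. apply frame_int_bound; [lra|lra| |].
    - intros z Hz.
      assert (Hzp : z <> p).
      { intros ->. apply Hdist in Hz. replace (p - p)%C with (RtoC 0) in Hz by ring.
        rewrite Cmod_0 in Hz. lra. }
      apply cdiff_ccont, (cdiff_mult (G n) (fun z => / (z - p))%C).
      + apply HG, Hz.
      + now apply cdiff_inv_shift.
    - intros z Hz. assert (D := Hdist z Hz).
      assert (Hn : (z - p)%C <> 0) by (apply Cmod_gt_0; lra).
      rewrite Cmod_mult, Cmod_inv by easy. unfold G. rewrite Cmod_pow, Cmod_mult, Cmod_inv by easy.
      apply Rmult_le_compat.
      + apply pow_le. apply Rmult_le_pos; [left; apply Rinv_0_lt_compat; lra|apply Cmod_ge_0].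
      + left. apply Rinv_0_lt_compat. lra.
      + apply pow_incr. split.
        * apply Rmult_le_pos; [left; apply Rinv_0_lt_compat; lra|apply Cmod_ge_0].
        * unfold q, Rdiv. rewrite Rmult_comm. apply Rmult_le_compat_r; [|now apply HK].
          left. apply Rinv_0_lt_compat. lra.
      + apply Rinv_le_contravar; lra. }
  destruct (pow_lt_1_zero q ltac:(rewrite Rabs_pos_eq; lra) (J * r / (2 * (b - a + (d - c)))))
    as [N HN].
  - apply Rdiv_lt_0_compat; [|lra]. apply Rmult_lt_0_compat; lra.
  - specialize (HN N (le_n N)). specialize (HJ N).
    rewrite Rabs_pos_eq in HN by (apply pow_le; lra).
    apply Rmult_lt_compat_r with (r := 2 * (b - a + (d - c)) * / r) in HN.
    + replace (J * r / (2 * (b - a + (d - c))) * (2 * (b - a + (d - c)) * / r)) with J in HN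
        by (field; lra). lra.
    + apply Rmult_lt_0_compat; [lra|]. apply Rinv_0_lt_compat. lra.
Qed.

(** * Weight sequences with a proximate order *)

Lemma quotients_pos (M : nat -> R) : (forall p, 0 < M p) -> forall p, 0 < quotients M p.
Proof. intros HM p. unfold quotients. apply Rdiv_lt_0_compat; apply HM. Qed.

Lemma quotients_spec (M : nat -> R) : (forall p, 0 < M p) ->
  forall p, M (S p) = M p * quotients M p.
Proof.
  intros HM p. unfold quotients. rewrite Nat.add_1_r. field.
  apply Rgt_not_eq, HM.
Qed.

Lemma quotients_le (M : nat -> R) : (forall p, 0 < M p) -> log_convex M ->
  forall p q, (p <= q)%nat -> quotients M p <= quotients M q.
Proof.
  intros HM HL p q Hpq. induction Hpq as [|q Hpq IH]; [lra|].
  apply Rle_trans with (1 := IH).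
  assert (H := HL (S q) ltac:(lia)). simpl in H. rewrite Nat.sub_0_r, Nat.add_1_r in H.
  unfold quotients. rewrite !Nat.add_1_r.
  assert (H1 := HM q). assert (H2 := HM (S q)).
  apply Rmult_le_reg_r with (M q * M (S q)); [now apply Rmult_lt_0_compat|].
  replace (M (S q) / M q * (M q * M (S q))) with (M (S q) * M (S q)) by (field; lra).
  replace (M (S (S q)) / M (S q) * (M q * M (S q))) with (M q * M (S (S q))) by (field; lra).
  lra.
Qed.

(** M_(q+k) is M_q times the quotients m_q, ..., m_(q+k-1); the last index is at most N when q + k
    <= N + 1. *)
Lemma weight_le (M : nat -> R) : (forall p, 0 < M p) -> log_convex M ->
  forall q k N, (q + k <= S N)%nat -> M (q + k)%nat <= M q * quotients M N ^ k.
Proof.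
  intros HM HL q k N. induction k as [|k IH]; intros H.
  - rewrite Nat.add_0_r. simpl. lra.
  - rewrite Nat.add_succ_r, (quotients_spec M HM (q + k)). simpl pow.
    rewrite (Rmult_comm (quotients M N)), <- Rmult_assoc.
    apply Rmult_le_compat.
    + left; apply HM.
    + left; apply quotients_pos; assumption.
    + apply IH. lia.
    + apply quotients_le; [easy|easy|lia].
Qed.

Lemma weight_ge (M : nat -> R) : (forall p, 0 < M p) -> log_convex M ->
  forall q k N, (N <= q)%nat -> M q * quotients M N ^ k <= M (q + k)%nat.
Proof.
  intros HM HL q k N H. assert (Hm := quotients_pos M HM).
  induction k as [|k IH].
  - rewrite Nat.add_0_r. simpl. lra.
  - rewrite Nat.add_succ_r, (quotients_spec M HM (q + k)). simpl pow.
    rewrite (Rmult_comm (quotients M N)), <- Rmult_assoc.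
    apply Rmult_le_compat.
    + apply Rmult_le_pos; [left; apply HM|apply pow_le; left; apply Hm].
    + left; apply Hm.
    + easy.
    + apply quotients_le; [easy|easy|lia].
Qed.

(** For t = m_N the terms t^p / M_p have successive ratios m_N / m_p, which are at least 1 for p <=
    N and at most 1 for p >= N. *)
Lemma quotient_pow_div_weight_max (M : nat -> R) : (forall p, 0 < M p) -> log_convex M ->
  forall N p, quotients M N ^ p / M p <= quotients M N ^ N / M N.
Proof.
  intros HM HL N p. assert (Hm := quotients_pos M HM N).
  assert (H1 := HM p). assert (H2 := HM N).
  apply Rmult_le_reg_r with (M p * M N); [now apply Rmult_lt_0_compat|].
  replace (quotients M N ^ p / M p * (M p * M N)) with (quotients M N ^ p * M N) by (field; lra).
  replace (quotients M N ^ N / M N * (M p * M N)) with (quotients M N ^ N * M p) by (field; lra).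
  destruct (Nat.le_ge_cases p N) as [L|L].
  - destruct (Nat.le_exists_sub _ _ L) as [k [-> _]].
    assert (B := weight_le M HM HL p k (k + p) ltac:(lia)).
    rewrite (Nat.add_comm p k) in B. rewrite (pow_add _ k p).
    assert (0 < quotients M (k + p) ^ p) by now apply pow_lt. nra.
  - destruct (Nat.le_exists_sub _ _ L) as [k [-> _]].
    assert (B := weight_ge M HM HL N k N ltac:(lia)).
    rewrite (Nat.add_comm N k) in B. rewrite (pow_add _ k N).
    assert (0 < quotients M N ^ N) by now apply pow_lt. nra.
Qed.

(** The upper bound shows that the supremum is finite, so [real] returns the supremum itself and not
    its default value 0. *)
Lemma assoc_fun_bounds (M : nat -> R) : (forall p, 0 < M p) -> log_convex M ->
  forall N t, 0 < t <= quotients M N ->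
  (forall p, ln (t ^ p / M p) <= assoc_fun M t) /\
  assoc_fun M t <= ln (quotients M N ^ N / M N).
Proof.
  intros HM HL N t Ht. unfold assoc_fun.
  assert (Hs := Sup_seq_correct (fun p => Finite (ln (t ^ p / M p)))).
  apply is_sup_seq_lub in Hs. destruct Hs as [Hub Hlub].
  set (s := Sup_seq _) in *.
  assert (U : Rbar_le s (ln (quotients M N ^ N / M N))).
  { apply Hlub. intros x [p ->]. simpl. apply ln_le.
    - apply Rdiv_lt_0_compat; [now apply pow_lt|apply HM].
    - eapply Rle_trans; [|apply (quotient_pow_div_weight_max M HM HL N p)].
      apply Rmult_le_compat_r; [left; apply Rinv_0_lt_compat, HM|].
      apply pow_incr. lra. }
  assert (L : forall p, Rbar_le (ln (t ^ p / M p)) s) by (intros p; apply Hub; now exists p).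
  destruct s as [s| |]; simpl in *; [tauto|tauto|].
  exfalso. exact (L 0%nat).
Qed.

Lemma le_of_derive_nonneg_except (f : R -> R) (l : list R) : forall a b, a <= b ->
  (forall x, a <= x <= b -> continuous f x) ->
  (forall x, a < x < b -> ~ List.In x l -> ex_derive f x /\ 0 <= Derive f x) ->
  f a <= f b.
Proof.
  induction l as [|e l IH]; intros a b Hab Hc Hd.
  (* The mean value point may be an endpoint, where nothing is known about the derivative;
     truncation at 0 makes the sign right there and changes nothing inside. *)
  - destruct (MVT_gen f a b (fun x => Rmax 0 (Derive f x))) as [x [Hx E]];
      rewrite ?Rmin_left, ?Rmax_right in * by lra.
    + intros x Hx. destruct (Hd x Hx) as [H1 H2]; [easy|].
      rewrite Rmax_right by easy. now apply Derive_correct.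
    + intros x Hx. now apply continuity_pt_filterlim, Hc.
    + assert (0 <= Rmax 0 (Derive f x) * (b - a)); [|lra].
      apply Rmult_le_pos; [apply Rmax_l|lra].
  - destruct (classic (a < e < b)) as [He|He].
    + apply Rle_trans with (f e); apply IH; try lra;
        try (intros x Hx; apply Hc; lra);
        intros x Hx Hn; (apply Hd; [lra|]); intros [E|E]; [lra|easy|lra|easy].
    + apply IH; [easy|easy|]. intros x Hx Hn. apply Hd; [easy|].
      intros [E|E]; [subst; tauto|easy].
Qed.

(* On (c, oo) the derivative of (rho x - l / 2) ln x is
   (x rho' ln x + rho - l / 2) / x, which is eventually positive. *)
Lemma proximate_order_growth (rho : R -> R) : nonzero_proximate_order rho ->
  forall K, exists H T, 1 < H /\ forall t, T <= t ->
    K <= rho (H * t) * ln (H * t) - rho t * ln t.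
Proof.
  intros (l & (c & Hc0 & Hcont & (E & [_ HE] & Hdiff & _) & _ & Hlim & Hder) & Hl) K.
  (* The two thresholds match: 3 l / 4 - l / 2 compensates the loss of l / 4 in the derivative
     term. *)
  assert (E1 : exists X, forall x, X < x -> l * 3 / 4 < rho x).
  { apply is_lim_spec in Hlim. simpl in Hlim.
    destruct (Hlim (mkposreal (l / 4) ltac:(lra))) as [X HX]. exists X.
    intros x Hx. specialize (HX x Hx). simpl in HX. apply Rabs_lt_between in HX. lra. }
  assert (E2 : exists X, forall x, X < x -> ex_derive rho x ->
    - (l / 4) < x * Derive rho x * ln x).
  { assert (B := proj1 (filterlim_locally _ _) Hder (mkposreal (l / 4) ltac:(lra))).
    destruct B as [X HX]. exists X. intros x Hx Hx'. specialize (HX x Hx Hx').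
    simpl in HX. unfold ball in HX; simpl in HX. unfold AbsRing_ball in HX; simpl in HX.
    apply Rabs_lt_between in HX. unfold minus, plus, opp in HX; simpl in HX. lra. }
  destruct E1 as [X1 H1], E2 as [X2 H2].
  (* Monotonicity of (rho x - l / 2) ln x yields a growth of at least (l / 2) ln H, hence of at
     least K; the maximum with 1 ensures H > 1. *)
  set (H := exp (Rmax 1 (2 * K / l))). set (T := Rmax 1 (Rmax (c + 1) (Rmax (X1 + 1) (X2 + 1)))).
  assert (HH : 1 < H).
  { unfold H. rewrite <- exp_0 at 1. apply exp_increasing.
    apply Rlt_le_trans with 1; [lra|apply Rmax_l]. }
  exists H, T. split; [easy|]. intros t Ht.
  assert (T1 : 1 <= t /\ c < t /\ X1 < t /\ X2 < t).
  { assert (A1 := Rmax_l 1 (Rmax (c + 1) (Rmax (X1 + 1) (X2 + 1)))).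
    assert (A2 := Rmax_r 1 (Rmax (c + 1) (Rmax (X1 + 1) (X2 + 1)))).
    assert (A3 := Rmax_l (c + 1) (Rmax (X1 + 1) (X2 + 1))).
    assert (A4 := Rmax_r (c + 1) (Rmax (X1 + 1) (X2 + 1))).
    assert (A5 := Rmax_l (X1 + 1) (X2 + 1)).
    assert (A6 := Rmax_r (X1 + 1) (X2 + 1)). unfold T in Ht. lra. }
  assert (Hle : t <= H * t) by nra.
  destruct (HE (H * t)) as [L HL].
  assert (G : (rho t - l / 2) * ln t <= (rho (H * t) - l / 2) * ln (H * t)).
  { apply (le_of_derive_nonneg_except (fun x => (rho x - l / 2) * ln x) L); [easy| |].
    - intros x Hx. apply (continuous_mult (K := R_AbsRing)).
      + apply (continuous_minus (V := R_NormedModule)); [apply Hcont; lra|apply continuous_const].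
      + apply (ex_derive_continuous (V := R_NormedModule) ln x). exists (/ x). apply is_derive_ln. lra.
    - intros x Hx Hn.
      destruct (Hdiff x) as [D _]; [lra| |].
      { intros He. apply Hn, HL; [easy|lra]. }
      assert (D' : is_derive (fun x => (rho x - l / 2) * ln x) x
        ((x * Derive rho x * ln x + (rho x - l / 2)) / x)).
      { auto_derive; [split; [easy|split; [lra|easy]]|].
        change (Derive (fun x => rho x) x) with (Derive rho x). field. lra. }
      split; [eexists; exact D'|].
      replace (Derive _ x) with ((x * Derive rho x * ln x + (rho x - l / 2)) / x)
        by (symmetry; exact (is_derive_unique _ _ _ D')).
      apply Rdiv_le_0_compat; [|lra].
      specialize (H1 x ltac:(lra)). specialize (H2 x ltac:(lra) D). lra. }
  rewrite ln_mult in * by lra.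
  assert (B : K <= l / 2 * ln H).
  { unfold H. rewrite ln_exp. apply Rle_trans with (l / 2 * (2 * K / l)).
    - right. field. lra.
    - apply Rmult_le_compat_l; [lra|apply Rmax_r]. }
  lra.
Qed.

Lemma quotients_unbounded (M : nat -> R) (x : R) : is_lim_seq (quotients M) p_infty ->
  exists N0, forall N, (N0 <= N)%nat -> x < quotients M N.
Proof. intros H. apply is_lim_seq_spec in H. exact (H x). Qed.

Lemma quotients_pow_le_eventually (M : nat -> R) :
  (forall p, 0 < M p) -> log_convex M -> is_lim_seq (quotients M) p_infty ->
  admits_nonzero_proximate_order M ->
  exists D N0, forall N, (N0 <= N)%nat -> quotients M N ^ N <= D ^ N * M N.
Proof.
  intros HM HL Hinf (rho & Hrho & A & B & [T1 HAB]).
  (* The difference of rho(t) ln t and ln M(t) stays in [A, B]; a growth of B - A + ln 2 of the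
     former therefore forces ln M to grow by ln 2. *)
  destruct (proximate_order_growth rho Hrho (B - A + ln 2)) as (H & T2 & HH & Hgrow).
  (* Beyond 2 the logarithm ln t is positive, and beyond M_1 the term of index 1 makes M(t)
     positive, so that ln M(t) is meaningful. *)
  set (T := Rmax (Rmax (T1 + 1) T2) (Rmax 2 (M 1%nat))).
  assert (HT : T1 + 1 <= T /\ T2 <= T /\ 2 <= T /\ M 1%nat <= T).
  { unfold T. repeat split.
    - eapply Rle_trans; [apply Rmax_l|apply Rmax_l].
    - eapply Rle_trans; [apply Rmax_r|apply Rmax_l].
    - eapply Rle_trans; [apply Rmax_l|apply Rmax_r].
    - eapply Rle_trans; [apply Rmax_r|apply Rmax_r]. }
  destruct (quotients_unbounded M (H * T) Hinf) as [N0 HN0].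
  exists (H * H), N0. intros N HN. specialize (HN0 N HN).
  set (m := quotients M N) in *. set (t := m / H).
  assert (Ht : T < t).
  { unfold t. apply Rmult_lt_reg_l with H; [lra|]. replace (H * (m / H)) with m by (field; lra). easy. }
  assert (Hm : m = H * t) by (unfold t; field; lra).
  assert (Htm : t < m) by nra.
  destruct (assoc_fun_bounds M HM HL N t ltac:(fold m; lra)) as [Lt _].
  destruct (assoc_fun_bounds M HM HL N m ltac:(fold m; lra)) as [Lm Um]. fold m in Um.
  (* The supremum at m = m_N is attained at index N. *)
  assert (Em : assoc_fun M m = ln (m ^ N / M N)) by (apply Rle_antisym; [easy|apply Lm]).
  assert (Hp1 : 0 < ln (t ^ 1 / M 1%nat)).
  { rewrite <- ln_1. apply ln_increasing; [lra|]. rewrite pow_1.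
    apply Rmult_lt_reg_r with (M 1%nat); [apply HM|].
    unfold Rdiv. rewrite Rmult_assoc, Rinv_l by (apply Rgt_not_eq, HM). lra. }
  assert (Pt : 0 < assoc_fun M t) by (generalize (Lt 1%nat); lra).
  assert (Pm : 0 < assoc_fun M m).
  { apply Rlt_le_trans with (1 := Hp1). eapply Rle_trans; [|apply (Lm 1%nat)].
    apply ln_le.
    - apply Rdiv_lt_0_compat; [apply pow_lt; lra|apply HM].
    - apply Rmult_le_compat_r; [left; apply Rinv_0_lt_compat, HM|]. apply pow_incr. lra. }
  assert (D : forall x, 1 < x -> ln x * (rho x - d_order M x) = rho x * ln x - ln (assoc_fun M x)).
  { intros x Hx. unfold d_order. field. apply Rgt_not_eq. rewrite <- ln_1. apply ln_increasing; lra. }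
  assert (At := HAB t ltac:(lra)). assert (Am := HAB m ltac:(lra)).
  rewrite D in At, Am by lra.
  assert (Gr := Hgrow t ltac:(lra)). rewrite <- Hm in Gr.
  assert (Hdouble : 2 * assoc_fun M t <= assoc_fun M m).
  { apply Rnot_lt_le. intros Hlt. apply ln_increasing in Hlt; [|easy].
    rewrite ln_mult in Hlt by lra. lra. }
  assert (HtN : ln (t ^ N / M N) = ln (m ^ N / M N) - ln (H ^ N)).
  { assert (0 < H ^ N) by (apply pow_lt; lra). assert (0 < t ^ N) by (apply pow_lt; lra).
    assert (HMN := HM N).
    replace (m ^ N / M N) with (H ^ N * (t ^ N / M N)) by (rewrite Hm, Rpow_mult_distr; field; lra).
    rewrite ln_mult; [ring|easy|]. apply Rdiv_lt_0_compat; lra. }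
  assert (Hfin : ln (m ^ N / M N) <= ln ((H * H) ^ N)).
  { rewrite Rpow_mult_distr, ln_mult by (apply pow_lt; lra). generalize (Lt N). lra. }
  assert (HMN := HM N).
  apply Rmult_le_reg_r with (/ M N); [now apply Rinv_0_lt_compat|].
  rewrite Rmult_assoc, Rinv_r, Rmult_1_r by lra.
  apply Rnot_lt_le. intros Hlt. apply ln_increasing in Hlt; [unfold Rdiv in Hfin; lra|].
  apply pow_lt. nra.
Qed.

(** Finitely many indices are absorbed by enlarging D, except N = 0, where both powers are 1 and M_0
    = 1 decides. *)
Lemma quotients_pow_le (M : nat -> R) :
  (forall p, 0 < M p) -> M 0%nat = 1 -> log_convex M ->
  is_lim_seq (quotients M) p_infty -> admits_nonzero_proximate_order M ->
  exists D, 1 <= D /\ forall N, quotients M N ^ N <= D ^ N * M N.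
Proof.
  intros HM H0 HL Hinf Hadm.
  destruct (quotients_pow_le_eventually M HM HL Hinf Hadm) as (D0 & N0 & HD0).
  assert (Hfin : forall n, exists D, 1 <= D /\
    forall N, (N < n)%nat -> quotients M N ^ N <= D ^ N * M N).
  { induction n as [|n [D [HD IH]]].
    - exists 1. split; [lra|]. intros N HN. lia.
    - exists (Rmax D (quotients M n ^ n / M n)).
      assert (HD1 := Rmax_l D (quotients M n ^ n / M n)).
      assert (HD2 := Rmax_r D (quotients M n ^ n / M n)).
      set (D' := Rmax D (quotients M n ^ n / M n)) in *.
      split; [lra|]. intros N HN. assert (HMN := HM N).
      destruct (Nat.eq_dec N n) as [->|Hne].
      + destruct n as [|n]; [simpl; lra|].
        apply Rmult_le_reg_r with (/ M (S n)); [now apply Rinv_0_lt_compat|].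
        rewrite Rmult_assoc, Rinv_r, Rmult_1_r by lra.
        apply Rle_trans with (1 := HD2). rewrite <- (pow_1 D') at 1.
        apply Rle_pow; [lra|lia].
      + eapply Rle_trans; [apply IH; lia|].
        apply Rmult_le_compat_r; [lra|]. apply pow_incr. lra. }
  destruct (Hfin N0) as [D [HD HDN]].
  exists (Rmax D (Rabs D0)). split; [eapply Rle_trans; [exact HD|apply Rmax_l]|].
  intros N. assert (HMN := HM N).
  destruct (Nat.lt_ge_cases N N0) as [L|L].
  - eapply Rle_trans; [now apply HDN|]. apply Rmult_le_compat_r; [lra|].
    apply pow_incr. split; [lra|apply Rmax_l].
  - eapply Rle_trans; [now apply HD0|]. apply Rmult_le_compat_r; [lra|].
    eapply Rle_trans; [apply Rle_abs|]. rewrite <- RPow_abs.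
    apply pow_incr. split; [apply Rabs_pos|apply Rmax_r].
Qed.

(** For m = m_(kq), log-convexity gives M_(kq) <= M_q m^(kq - q); inserted into m^(kq) <= D^(kq)
    M_(kq), this cancels all but q of the factors m. *)
Lemma quotients_mult_pow_le (M : nat -> R) (D : R) :
  (forall p, 0 < M p) -> log_convex M ->
  (forall N, quotients M N ^ N <= D ^ N * M N) ->
  forall k q, (1 <= k)%nat -> quotients M (k * q) ^ q <= (D ^ k) ^ q * M q.
Proof.
  intros HM HL HD k q Hk. destruct k as [|k]; [lia|].
  assert (Hm := quotients_pos M HM (S k * q)).
  assert (B := HD (S k * q)%nat).
  assert (W := weight_le M HM HL q (k * q) (S k * q) ltac:(lia)).
  replace (q + k * q)%nat with (S k * q)%nat in W by lia.
  set (m := quotients M (S k * q)) in *.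
  apply Rmult_le_reg_r with (m ^ (k * q)); [now apply pow_lt|].
  rewrite <- pow_add, <- pow_mult, Rmult_assoc.
  replace (q + k * q)%nat with (S k * q)%nat by lia.
  eapply Rle_trans; [exact B|].
  destruct (Rle_lt_dec 0 (D ^ (S k * q))) as [P|P].
  - now apply Rmult_le_compat_l.
  - assert (HP := HM (S k * q)%nat). assert (0 < m ^ (S k * q)) by now apply pow_lt. nra.
Qed.

(** * The two-constants theorem on a half-strip *)

Lemma exp_le_compat (x y : R) : x <= y -> exp x <= exp y.
Proof. intros [H| ->]; [left; now apply exp_increasing|lra]. Qed.

(** The quotient is the affine parameter equal to 1 at u and 0 at v. Both orders of u and v occur,
    as strips lie on either side of theta. *)
Lemma Rmin_Rmax_between (u v y : R) : u <> v -> Rmin u v <= y <= Rmax u v ->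
  0 <= (v - y) / (v - u) <= 1.
Proof.
  intros Huv Hy.
  assert (E : 1 - (v - y) / (v - u) = (y - u) / (v - u)) by (field; lra).
  destruct (Rle_lt_dec u v) as [L|L].
  - rewrite Rmin_left, Rmax_right in Hy by lra.
    assert (0 <= (v - y) / (v - u)) by (apply Rdiv_le_0_compat; lra).
    assert (0 <= (y - u) / (v - u)) by (apply Rdiv_le_0_compat; lra). lra.
  - rewrite Rmin_right, Rmax_left in Hy by lra.
    assert (0 <= (y - v) / (u - v)) by (apply Rdiv_le_0_compat; lra).
    assert (0 <= (u - y) / (u - v)) by (apply Rdiv_le_0_compat; lra).
    replace ((v - y) / (v - u)) with ((y - v) / (u - v)) in * by (field; lra).
    replace ((y - u) / (v - u)) with ((u - y) / (u - v)) in * by (field; lra). lra.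
Qed.

(* The exponent is harmonic and linear in each variable, hence the real part of
   a quadratic polynomial; adding the real part of eps (v^2 + (Y - theta)^2),
   which grows quadratically at the far end, reduces the claim to the maximum
   principle on long rectangles. *)
Lemma half_strip_two_constants (g : C -> C) (X theta Y K p : R) :
  theta <> Y -> 0 <= p ->
  (forall z, fst z <= X -> Rmin theta Y <= snd z <= Rmax theta Y ->
    cdiff g z /\ Cmod (g z) <= K) ->
  (forall x, x <= X -> Cmod (g (x, theta)) <= K * exp (p * (x - X))) ->
  forall z, fst z <= X -> Rmin theta Y <= snd z <= Rmax theta Y ->
    Cmod (g z) <= K * exp (p * (fst z - X) * ((Y - snd z) / (Y - theta))).
Proof.
  intros HY Hp Hg Hth z0 Hz1 Hz2.
  set (tau := Y - theta). assert (Htau : tau <> 0) by (unfold tau; lra).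
  assert (Htau2 : 0 < tau ^ 2) by (simpl; nra).
  assert (HK : 0 <= K).
  { eapply Rle_trans; [apply Cmod_ge_0|apply (Hg z0 Hz1 Hz2)]. }
  set (phi := fun z : C => p * (fst z - X) * ((Y - snd z) / tau)).
  set (psi := fun z : C => (fst z - X) ^ 2 + (tau ^ 2 - (snd z - theta) ^ 2)).
  assert (Hy : forall z : C, Rmin theta Y <= snd z <= Rmax theta Y ->
    0 <= (Y - snd z) / tau <= 1 /\ 0 <= tau ^ 2 - (snd z - theta) ^ 2).
  { intros z Hz. assert (B := Rmin_Rmax_between theta Y (snd z) HY Hz). fold tau in B.
    split; [easy|]. set (u := (Y - snd z) / tau) in *.
    replace (snd z - theta) with (tau * (1 - u)) by (unfold u, tau; field; easy).
    simpl in *. assert (0 <= 1 - (1 - u) * (1 - u)) by nra. nra. }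
  assert (Heps : forall eps, 0 < eps -> Cmod (g z0) <= K * exp (phi z0 + eps * psi z0)).
  { intros eps He.
    (* In k (z - w0)^2 the real part of k gives the quadratic damping, and its imaginary part gives
       the mixed product of fst z - X and snd z - theta in [phi]. *)
    set (w0 := (X, theta) : C). set (k := (- eps, - (p / (2 * tau))) : C).
    set (E := fun z => (RtoC (- p) * (z - w0) + k * ((z - w0) * (z - w0)) + RtoC (- (eps * tau ^ 2)))%C).
    assert (HE : forall z, fst (E z) = - (phi z + eps * psi z)).
    { intros [x y]. unfold E, phi, psi, k, w0, RtoC, Cminus, Cplus, Cmult, Copp; simpl.
      unfold tau in *. field. lra. }
    assert (HdE : forall z, cdiff E z).
    { intros z. unfold E.
      assert (Hv : cdiff (fun z => z - w0)%C z)
        by (apply (cdiff_minus (fun z => z)); [apply cdiff_id|apply cdiff_const]).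
      apply (cdiff_plus (fun z => RtoC (- p) * (z - w0) + k * ((z - w0) * (z - w0)))%C);
        [|apply cdiff_const].
      apply (cdiff_plus (fun z => RtoC (- p) * (z - w0))%C).
      - apply (cdiff_mult (fun _ => RtoC (- p))); [apply cdiff_const|exact Hv].
      - apply (cdiff_mult (fun _ => k) (fun z => (z - w0) * (z - w0))%C); [apply cdiff_const|].
        apply (cdiff_mult (fun z => z - w0)%C (fun z => z - w0)%C); exact Hv. }
    set (G := fun z => (g z * cexp (E z))%C).
    (* At the far side eps L^2 >= p L, so the damping outweighs [phi]; the second bound places z0
       inside the rectangle. *)
    set (L := Rmax (p / eps) (X - fst z0)).
    assert (HL1 : p <= L * eps).
    { assert (B := Rmax_l (p / eps) (X - fst z0)). fold L in B.
      apply Rmult_le_compat_r with (r := eps) in B; [|lra].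
      unfold Rdiv in B. rewrite Rmult_assoc, Rinv_l in B by lra. lra. }
    assert (HL2 : X - fst z0 <= L) by apply Rmax_r.
    assert (HL0 : 0 <= L).
    { eapply Rle_trans; [|apply Rmax_l]. apply Rdiv_le_0_compat; lra. }
    assert (HG : Cmod (G z0) <= K).
    { apply (maximum_principle G (X - L) X (Rmin theta Y) (Rmax theta Y)).
      - intros z [Hz Hz']. apply (cdiff_mult g (fun z => cexp (E z))).
        + apply Hg; lra.
        + apply (cdiff_comp cexp E); [apply cdiff_cexp|apply HdE].
      - intros z [[Hz Hz'] Hf].
        unfold G. rewrite Cmod_mult, Cmod_cexp, HE.
        destruct (Hy z Hz') as [Hu Ht].
        assert (Hs2 : 0 <= (fst z - X) ^ 2) by apply pow2_ge_0.
        (* On the three other sides the factor has modulus at most 1 and |g| <= K suffices; on the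
           side theta it may be large, and the decay of g compensates. *)
        assert (Hcase : snd z = theta \/ 0 <= phi z + eps * psi z).
        { assert (Hf' : fst z = X - L \/ fst z = X \/ snd z = theta \/ snd z = Y).
          { unfold Rmin, Rmax in Hf; destruct (Rle_dec theta Y); tauto. }
          destruct Hf' as [Hx|[Hx|[Hx|Hx]]]; [right|right|now left|right]; unfold phi, psi in *.
          - rewrite Hx in *. replace (X - L - X) with (- L) in * by ring.
            set (u := (Y - snd z) / tau) in *.
            assert (0 <= eps * (tau ^ 2 - (snd z - theta) ^ 2)) by (apply Rmult_le_pos; lra).
            assert (p * L * u <= p * L) by (assert (0 <= p * L) by nra; nra).
            simpl in *. nra.
          - rewrite Hx in *. replace (X - X) with 0 in * by ring.
            assert (0 <= eps * (tau ^ 2 - (snd z - theta) ^ 2)) by (apply Rmult_le_pos; lra).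
            lra.
          - rewrite Hx. replace ((Y - Y) / tau) with 0 by (field; easy).
            fold tau. assert (0 <= eps * (fst z - X) ^ 2) by (apply Rmult_le_pos; lra). lra. }
        destruct Hcase as [Hx|Hx].
        + assert (Hphi : p * (fst z - X) <= phi z + eps * psi z).
          { unfold phi, psi in *. rewrite Hx in *. fold tau in Hu |- *.
            replace (tau / tau) with 1 by (field; easy).
            assert (0 <= eps * ((fst z - X) ^ 2 + (tau ^ 2 - (theta - theta) ^ 2)))
              by (apply Rmult_le_pos; lra). lra. }
          assert (Bz := Hth (fst z) ltac:(lra)).
          rewrite <- Hx, <- surjective_pairing in Bz.
          apply Rle_trans with (K * exp (p * (fst z - X)) * exp (- (phi z + eps * psi z))).
          * apply Rmult_le_compat_r; [left; apply exp_pos|exact Bz].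
          * rewrite Rmult_assoc, <- exp_plus. rewrite <- (Rmult_1_r K) at 2.
            apply Rmult_le_compat_l; [easy|]. rewrite <- exp_0. apply exp_le_compat. lra.
        + rewrite <- (Rmult_1_r K). apply Rmult_le_compat.
          * apply Cmod_ge_0.
          * left; apply exp_pos.
          * apply Hg; lra.
          * rewrite <- exp_0. apply exp_le_compat. lra.
      - split; lra. }
    unfold G in HG. rewrite Cmod_mult, Cmod_cexp, HE, exp_Ropp in HG.
    apply Rmult_le_reg_r with (/ exp (phi z0 + eps * psi z0)).
    - apply Rinv_0_lt_compat, exp_pos.
    - rewrite Rmult_assoc, Rinv_r by (apply Rgt_not_eq, exp_pos). lra. }
  fold tau. change (Cmod (g z0) <= K * exp (phi z0)).
  apply Rnot_lt_le. intros Hlt.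
  assert (Hpsi : 0 <= psi z0).
  { destruct (Hy z0 Hz2) as [_ Ht]. unfold psi. generalize (pow2_ge_0 (fst z0 - X)). lra. }
  assert (HK' : 0 < K).
  { destruct HK as [HK|HK]; [easy|]. specialize (Heps 1 Rlt_0_1).
    rewrite <- HK in Heps, Hlt. lra. }
  set (y0 := K * exp (phi z0)) in *.
  assert (Hy0 : 0 < y0) by (apply Rmult_lt_0_compat; [easy|apply exp_pos]).
  assert (Hr : 0 < ln (Cmod (g z0) / y0)).
  { rewrite <- ln_1. apply ln_increasing; [lra|].
    apply Rmult_lt_reg_r with y0; [easy|]. unfold Rdiv. rewrite Rmult_assoc, Rinv_l; lra. }
  set (r := ln (Cmod (g z0) / y0)) in *.
  (* This replaces the limit eps -> 0: [r] is the logarithmic excess over the claimed bound, and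
     this eps keeps eps psi(z0) below it. *)
  assert (He : 0 < r / (psi z0 + 1)) by (apply Rdiv_lt_0_compat; lra).
  specialize (Heps _ He). rewrite exp_plus, <- Rmult_assoc in Heps. fold y0 in Heps.
  assert (Hb : r / (psi z0 + 1) * psi z0 < r).
  { apply Rlt_le_trans with (r / (psi z0 + 1) * (psi z0 + 1)).
    - apply Rmult_lt_compat_l; lra.
    - right. field. lra. }
  apply exp_increasing in Hb.
  replace (exp r) with (Cmod (g z0) / y0) in Hb
    by (unfold r; rewrite exp_ln; [easy|apply Rdiv_lt_0_compat; lra]).
  apply Rmult_lt_compat_l with (r := y0) in Hb; [|easy].
  replace (y0 * (Cmod (g z0) / y0)) with (Cmod (g z0)) in Hb by (field; lra). lra.
Qed.

(** * Propagation of the expansion *)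

(** The chain rule, from the variable z to its logarithm: the limit l with respect to [proj] is
    multiplied by the derivative k of [cexp]. Division by the increment of [cexp] requires that
    increment to be nonzero near z, hence the lower bound proved first. *)
Lemma holomorphic_on_cdiff (f : log_surface -> C) (G : log_surface -> Prop) :
  holomorphic_on f G -> forall z, G z -> cdiff f z.
Proof.
  intros Hf z Hz. destruct (Hf z Hz) as [l Hl].
  destruct (proj1 (cdiff_eps cexp z) (cdiff_cexp z)) as [k Hk].
  assert (Ek : exists P, 0 < P /\ exists d, 0 < d /\ forall w : C, Cmod (w - z) < d ->
    P * Cmod (w - z) <= Cmod (cexp w - cexp z)).
  { exists (Cmod (cexp z) / 2).
    assert (HP : 0 < Cmod (cexp z)) by (rewrite Cmod_cexp; apply exp_pos).
    split; [lra|]. exists (/ 40). split; [lra|]. intros w Hw.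
    set (h := (w - z)%C) in *. replace w with (z + h)%C by (unfold h; ring).
    assert (B := cexp_taylor_1_bound h ltac:(lra)).
    rewrite cexp_plus. replace (cexp z * cexp h - cexp z)%C with (cexp z * (h - - (cexp h - 1 - h)))%C by ring.
    rewrite Cmod_mult. assert (B' := Cmod_triangle_inv h (- (cexp h - 1 - h))).
    rewrite Cmod_opp in B'. assert (Hh := Cmod_ge_0 h). simpl in B.
    assert (Cmod h / 2 <= Cmod (h - - (cexp h - 1 - h))) by nra.
    unfold Rdiv. rewrite Rmult_assoc. apply Rmult_le_compat_l; [lra|]. lra. }
  destruct Ek as (P & HP & d0 & Hd0 & Hlow).
  apply cdiff_eps. exists (l * k)%C. intros eps Heps.
  assert (HQ : 0 <= Cmod l) by apply Cmod_ge_0.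
  assert (HQ' : 0 <= Cmod k) by apply Cmod_ge_0.
  (* The limit in [holomorphic_on] uses the product structure of [C], whose balls are squares: |q -
     l| is only below 2 e1. *)
  set (e1 := eps / (4 * (Cmod k + 1))).
  assert (He1 : 0 < e1) by (apply Rdiv_lt_0_compat; lra).
  assert (Ee1 : 2 * e1 * (Cmod k + 1) = eps / 2) by (unfold e1; field; lra).
  set (e2 := Rmin 1 (eps / (2 * (Cmod l + 1)))).
  assert (He2 : 0 < e2) by (apply Rmin_pos; [lra|]; apply Rdiv_lt_0_compat; lra).
  assert (He2' : e2 <= 1) by apply Rmin_l.
  assert (Ee2 : Cmod l * e2 <= eps / 2).
  { apply Rle_trans with (Cmod l * (eps / (2 * (Cmod l + 1)))).
    - apply Rmult_le_compat_l; [easy|apply Rmin_r].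
    - apply Rmult_le_reg_r with (2 * (Cmod l + 1)); [lra|].
      replace (Cmod l * (eps / (2 * (Cmod l + 1))) * (2 * (Cmod l + 1))) with (Cmod l * eps) by (field; lra).
      nra. }
  destruct (proj1 (filterlim_locally (U := C_UniformSpace) _ _) Hl (mkposreal e1 He1)) as [d1 Hd1].
  destruct (Hk e2 He2) as (d2 & Hd2 & Hrem).
  exists (Rmin d0 (Rmin d1 d2)). split.
  { apply Rmin_pos; [easy|]. apply Rmin_pos; [apply cond_pos|easy]. }
  intros w Hw.
  assert (W0 := Rlt_le_trans _ _ _ Hw (Rmin_l _ _)).
  assert (W1 := Rlt_le_trans _ _ _ Hw (Rle_trans _ _ _ (Rmin_r _ _) (Rmin_l _ _))).
  assert (W2 := Rlt_le_trans _ _ _ Hw (Rle_trans _ _ _ (Rmin_r _ _) (Rmin_r _ _))).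
  destruct (classic (w = z)) as [->|Hwz].
  { replace (f z - f z - l * k * (z - z))%C with (RtoC 0) by ring.
    rewrite Cmod_0. apply Rmult_le_pos; [lra|apply Cmod_ge_0]. }
  assert (Hwz' : 0 < Cmod (w - z)).
  { apply Cmod_gt_0. intros E. apply Hwz. replace w with (w - z + z)%C by ring. rewrite E. ring. }
  specialize (Hlow w W0). specialize (Hrem w W2).
  assert (Hb : ball (M := log_surface) z d1 w).
  { assert (A1 := re_le_Cmod (w - z)). assert (A2 := Im_le_Cmod (w - z)). split.
    - eapply Rle_lt_trans; [exact A1|exact W1].
    - eapply Rle_lt_trans; [exact A2|exact W1]. }
  destruct (Hd1 w Hb Hwz) as [B1 B2].
  change (proj w) with (cexp w) in *. change (proj z) with (cexp z) in *.
  set (u := (cexp w - cexp z)%C) in *.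
  assert (Hu : u <> 0) by (apply Cmod_gt_0; nra).
  set (q := ((f w - f z) / u)%C) in *.
  assert (Bq : Cmod (q - l) <= 2 * e1).
  { eapply Rle_trans; [apply (Cmod_le_Rabs (fst q - fst l) (snd q - snd l))|].
    change (Rabs (fst q - fst l) < e1) in B1. change (Rabs (snd q - snd l) < e1) in B2. lra. }
  replace (f w - f z - l * k * (w - z))%C with ((q - l) * u + l * (u - k * (w - z)))%C
    by (unfold q; field; exact Hu).
  eapply Rle_trans; [apply Cmod_triangle|]. rewrite !Cmod_mult.
  assert (Bu : Cmod u <= (Cmod k + 1) * Cmod (w - z)).
  { replace u with ((u - k * (w - z)) + k * (w - z))%C by ring.
    eapply Rle_trans; [apply Cmod_triangle|]. rewrite Cmod_mult. nra. }
  assert (T1 : Cmod (q - l) * Cmod u <= 2 * e1 * ((Cmod k + 1) * Cmod (w - z)))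
    by (apply Rmult_le_compat; try apply Cmod_ge_0; easy).
  assert (T2 : Cmod l * Cmod (u - k * (w - z)) <= Cmod l * (e2 * Cmod (w - z)))
    by (apply Rmult_le_compat_l; easy).
  rewrite <- Rmult_assoc in T1, T2. rewrite Ee1 in T1.
  assert (Cmod l * e2 * Cmod (w - z) <= eps / 2 * Cmod (w - z)) by (apply Rmult_le_compat_r; lra).
  lra.
Qed.

Lemma cdiff_partial_sum (a : nat -> C) (p : nat) (z : C) :
  cdiff (fun w => partial_sum a (cexp w) p) z.
Proof.
  induction p as [|p IH].
  - exact (cdiff_const 0 z).
  - apply (cdiff_plus (fun w => partial_sum a (cexp w) p) (fun w => a p * cexp w ^ p)%C); [easy|].
    apply (cdiff_mult (fun _ => a p) (fun w => cexp w ^ p)%C); [apply cdiff_const|].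
    apply cdiff_pow, cdiff_cexp.
Qed.

Lemma Cmod_term_le (M : nat -> R) (a : nat -> C) (K A : R) (n : nat) (w : C) :
  Cmod (a n) <= K * A ^ n * M n -> Cmod (a n * w ^ n) <= K * A ^ n * (M n * Cmod w ^ n).
Proof.
  intros H. rewrite Cmod_mult, Cmod_pow, <- (Rmult_assoc _ (M n)).
  apply Rmult_le_compat_r; [apply pow_le, Cmod_ge_0|easy].
Qed.

(** The terms from index q on are dominated by a geometric series of ratio 1/2. The case q = 0
    bounds a whole partial sum independently of its length. *)
Lemma partial_sum_diff_le (M : nat -> R) (a : nat -> C) (K A mu : R) (q k : nat) (w : C) :
  0 <= K -> 0 <= A -> 0 <= mu -> 0 < M q ->
  (forall n, Cmod (a n) <= K * A ^ n * M n) ->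
  (forall j, (j <= k)%nat -> M (q + j)%nat <= M q * mu ^ j) ->
  A * mu * Cmod w <= / 2 ->
  Cmod (partial_sum a w (q + k) - partial_sum a w q) <= 2 * K * A ^ q * M q * Cmod w ^ q.
Proof.
  intros HK HA Hmu HMq Ha HM Hw.
  set (T := K * A ^ q * M q * Cmod w ^ q).
  assert (Hwp := Cmod_ge_0 w).
  assert (HT : 0 <= T).
  { unfold T. repeat apply Rmult_le_pos; try lra; apply pow_le; lra. }
  assert (H : forall j, (j <= k)%nat ->
    Cmod (partial_sum a w (q + j) - partial_sum a w q) <= 2 * T * (1 - (/ 2) ^ j)).
  { induction j as [|j IH]; intros Hj.
    - rewrite Nat.add_0_r. replace (partial_sum a w q - partial_sum a w q)%C with (RtoC 0) by ring.
      rewrite Cmod_0. simpl. lra.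
    - rewrite Nat.add_succ_r. simpl partial_sum.
      replace (partial_sum a w (q + j) + a (q + j)%nat * w ^ (q + j) - partial_sum a w q)%C
        with ((partial_sum a w (q + j) - partial_sum a w q) + a (q + j)%nat * w ^ (q + j))%C by ring.
      eapply Rle_trans; [apply Cmod_triangle|].
      assert (B := Cmod_term_le M a K A (q + j) w (Ha _)).
      assert (B' : K * A ^ (q + j) * (M (q + j)%nat * Cmod w ^ (q + j)) <= T * (/ 2) ^ j).
      { apply Rle_trans with (T * (A * mu * Cmod w) ^ j).
        - unfold T. rewrite !pow_add, !Rpow_mult_distr.
          replace (K * A ^ q * M q * Cmod w ^ q * (A ^ j * mu ^ j * Cmod w ^ j)) with
            (K * (A ^ q * A ^ j) * (M q * mu ^ j * (Cmod w ^ q * Cmod w ^ j))) by ring.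
          apply Rmult_le_compat_l.
          + repeat apply Rmult_le_pos; try apply pow_le; easy.
          + apply Rmult_le_compat_r; [apply Rmult_le_pos; apply pow_le; easy|].
            apply HM. lia.
        - apply Rmult_le_compat_l; [easy|]. apply pow_incr. split; [|easy].
          repeat apply Rmult_le_pos; easy. }
      specialize (IH ltac:(lia)). simpl pow at 1. lra. }
  specialize (H k (le_n k)). assert (0 <= (/ 2) ^ k) by (apply pow_le; lra).
  replace (2 * K * A ^ q * M q * Cmod w ^ q) with (2 * T) by (unfold T; ring). nra.
Qed.

Lemma INR_le_pow2 (n : nat) : INR n <= 2 ^ n.
Proof.
  induction n as [|n IH]; [simpl; lra|]. rewrite S_INR. simpl pow.
  assert (1 <= 2 ^ n) by (apply pow_R1_Rle; lra). lra.
Qed.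

(** For w that is not small there is no geometric decay: the q terms are bounded uniformly and their
    number is absorbed into 2^q. *)
Lemma partial_sum_le (M : nat -> R) (a : nat -> C) (K A B : R) (q : nat) (w : C) :
  0 <= K -> 1 <= A -> 0 <= B -> 0 < M q ->
  (forall n, Cmod (a n) <= K * A ^ n * M n) ->
  (forall n, (n <= q)%nat -> M n * Cmod w ^ n <= B ^ q * M q * Cmod w ^ q) ->
  Cmod (partial_sum a w q) <= K * (2 * A * B) ^ q * M q * Cmod w ^ q.
Proof.
  intros HK HA HB HMq Ha HM.
  set (U := B ^ q * M q * Cmod w ^ q).
  assert (HU : 0 <= U).
  { unfold U. repeat apply Rmult_le_pos; try (apply pow_le; try apply Cmod_ge_0; lra). lra. }
  assert (HAq : 1 <= A ^ q) by (apply pow_R1_Rle; lra).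
  assert (H : forall k, (k <= q)%nat -> Cmod (partial_sum a w k) <= INR k * (K * A ^ q * U)).
  { induction k as [|k IH]; intros Hk.
    - simpl. rewrite Cmod_0. lra.
    - simpl partial_sum. eapply Rle_trans; [apply Cmod_triangle|].
      assert (T := Cmod_term_le M a K A k w (Ha k)).
      assert (T' : K * A ^ k * (M k * Cmod w ^ k) <= K * A ^ q * U).
      { apply Rle_trans with (K * A ^ k * U).
        - apply Rmult_le_compat_l; [apply Rmult_le_pos; [easy|apply pow_le; lra]|].
          apply HM. lia.
        - apply Rmult_le_compat_r; [easy|]. apply Rmult_le_compat_l; [easy|].
          apply Rle_pow; [easy|lia]. }
      specialize (IH ltac:(lia)). rewrite S_INR. lra. }
  eapply Rle_trans; [apply (H q (le_n q))|].
  replace (K * (2 * A * B) ^ q * M q * Cmod w ^ q) with (2 ^ q * (K * A ^ q * U))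
    by (unfold U; rewrite !Rpow_mult_distr; ring).
  apply Rmult_le_compat_r; [|apply INR_le_pow2].
  apply Rmult_le_pos; [apply Rmult_le_pos; lra|easy].
Qed.

Lemma exp_pow_INR (n : nat) (x : R) : exp (INR n * x) = exp x ^ n.
Proof.
  induction n as [|n IH]; [simpl; rewrite Rmult_0_l; apply exp_0|].
  rewrite S_INR. simpl pow. rewrite <- IH, <- exp_plus. f_equal. ring.
Qed.

Lemma half_strip_expansion (M : nat -> R) (f : C -> C) (a : nat -> C)
    (D X theta Y K A C0 delta : R) :
  (forall p, 0 < M p) -> M 0%nat = 1 -> log_convex M ->
  1 <= D -> (forall N, quotients M N ^ N <= D ^ N * M N) ->
  theta <> Y -> 0 < K -> 0 < A -> 0 < delta ->
  (forall z, fst z <= X -> Rmin theta Y <= snd z <= Rmax theta Y ->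
    cdiff f z /\ Cmod (f z) <= C0) ->
  (forall n, Cmod (a n) <= K * A ^ n * M n) ->
  (forall x, x <= X -> forall p,
    Cmod (f (x, theta) - partial_sum a (cexp (x, theta)) p) <= K * A ^ p * M p * exp x ^ p) ->
  exists K' A', 0 < K' /\ 0 < A' /\
    forall z, fst z <= X -> Rmin theta Y <= snd z <= Rmax theta Y ->
      delta <= (Y - snd z) / (Y - theta) ->
      forall q, Cmod (f z - partial_sum a (cexp z) q) <= K' * A' ^ q * M q * exp (fst z) ^ q.
Proof.
  intros HM HM0 HL HD HDN HY HK HA Hdelta Hf Ha Hth.
  assert (HC0 : 0 <= C0).
  { eapply Rle_trans; [apply Cmod_ge_0|apply (Hf (X, theta)); simpl; [lra|]].
    split; [apply Rmin_l|apply Rmax_l]. }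
  (* With k delta > 1 the exponent p lambda for p = k q is at least q wherever lambda >= delta. *)
  destruct (INR_archimed delta 1 Hdelta) as [k Hk].
  assert (Hk1 : (1 <= k)%nat).
  { destruct k; [simpl in Hk; lra|lia]. }
  assert (Hm := quotients_pos M HM).
  (* 2 A <= B gives the ratio 1/2 of the geometric series when |w| <= 1 / (B mu); the last bound
     gives 1 / (B mu) <= exp X for every q, so the shortened strip lies in the given one. *)
  set (B := Rmax 1 (Rmax (2 * A) (exp (- X) / quotients M 0))).
  assert (HB : 1 <= B /\ 2 * A <= B /\ exp (- X) <= B * quotients M 0).
  { unfold B. split; [apply Rmax_l|]. split; [eapply Rle_trans; [apply Rmax_l|apply Rmax_r]|].
    apply Rmult_le_reg_r with (/ quotients M 0); [apply Rinv_0_lt_compat, Hm|].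
    rewrite Rmult_assoc, Rinv_r, Rmult_1_r by (apply Rgt_not_eq, Hm).
    eapply Rle_trans; [apply Rmax_r|apply Rmax_r]. }
  clearbody B. destruct HB as (HB1 & HB2 & HB3).
  assert (HDk : 1 <= D ^ k) by now apply pow_R1_Rle.
  set (E := D ^ k) in *. set (A1 := Rmax 1 A).
  assert (HA1 : 1 <= A1 /\ A <= A1) by (split; [apply Rmax_l|apply Rmax_r]).
  assert (HBE : 1 <= B * E) by nra.
  assert (HA1BE : 1 <= A1 * (B * E)) by nra.
  exists (C0 + 2 * K + 2 * K), (2 * A1 * (B * E)).
  split; [lra|]. split; [nra|].
  intros z Hz1 Hz2 Hdz q.
  assert (HMq := HM q).
  set (p := (k * q)%nat). set (mu := quotients M p).
  assert (Hmu : 0 < mu) by apply Hm.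
  assert (HmuE : mu ^ q <= E ^ q * M q) by now apply quotients_mult_pow_le.
  assert (HBmu : exp (- X) <= B * mu).
  { eapply Rle_trans; [exact HB3|]. apply Rmult_le_compat_l; [lra|].
    apply quotients_le; [easy|easy|lia]. }
  assert (HBmu0 : 0 < B * mu) by nra.
  assert (Ha1 : forall n, Cmod (a n) <= K * A1 ^ n * M n).
  { intros n. eapply Rle_trans; [apply Ha|].
    apply Rmult_le_compat_r; [left; apply HM|]. apply Rmult_le_compat_l; [lra|].
    apply pow_incr. lra. }
  assert (HMmu : forall n, (n <= p)%nat -> M n <= mu ^ n).
  { intros n Hn. assert (W := weight_le M HM HL 0 n p ltac:(lia)).
    rewrite HM0, Rmult_1_l in W. exact W. }
  assert (Hpq : (q <= p)%nat) by (unfold p; nia).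
  set (r := exp (fst z)).
  assert (Hr : 0 < r) by apply exp_pos.
  assert (Hcr : Cmod (cexp z) = r) by apply Cmod_cexp.
  assert (HBmuq : (B * mu * r) ^ q <= (B * E) ^ q * M q * r ^ q).
  { rewrite !Rpow_mult_distr. apply Rmult_le_compat_r; [apply pow_le; lra|].
    rewrite (Rmult_assoc (B ^ q)). apply Rmult_le_compat_l; [apply pow_le; lra|easy]. }
  assert (Hlast : forall x, x <= C0 + 2 * K ->
    x * ((B * E) ^ q * M q * r ^ q) + 2 * K * A1 ^ q * (B * E) ^ q * M q * r ^ q <=
    (C0 + 2 * K + 2 * K) * (2 * A1 * (B * E)) ^ q * M q * r ^ q).
  { intros x Hx. rewrite (Rpow_mult_distr (2 * A1)), (Rpow_mult_distr 2).
    set (U := (B * E) ^ q * M q * r ^ q).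
    assert (HU : 0 <= U).
    { unfold U. apply Rmult_le_pos; [apply Rmult_le_pos; [apply pow_le|]|apply pow_le]; lra. }
    assert (P1 : 1 <= 2 ^ q) by (apply pow_R1_Rle; lra).
    assert (P2 : 1 <= A1 ^ q) by (apply pow_R1_Rle; lra).
    assert (P3 : A1 ^ q <= 2 ^ q * A1 ^ q) by nra.
    replace (2 * K * A1 ^ q * (B * E) ^ q * M q * r ^ q) with (2 * K * A1 ^ q * U) by (unfold U; ring).
    replace ((C0 + 2 * K + 2 * K) * (2 ^ q * A1 ^ q * (B * E) ^ q) * M q * r ^ q)
      with ((C0 + 2 * K) * (2 ^ q * A1 ^ q) * U + 2 * K * (2 ^ q * A1 ^ q) * U) by (unfold U; ring).
    apply Rplus_le_compat.
    - apply Rmult_le_compat_r; [easy|].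
      apply Rle_trans with (C0 + 2 * K); [easy|].
      rewrite <- (Rmult_1_r (C0 + 2 * K)) at 1. apply Rmult_le_compat_l; lra.
    - apply Rmult_le_compat_r; [easy|]. apply Rmult_le_compat_l; lra. }
  set (X' := - ln (B * mu)).
  assert (HX' : exp (- X') = B * mu) by (unfold X'; rewrite Ropp_involutive; now apply exp_ln).
  assert (HX'X : X' <= X).
  { apply Rnot_lt_le. intros L. assert (exp (- X') < exp (- X)) by (apply exp_increasing; lra). lra. }
  destruct (Rle_lt_dec (fst z) X') as [Hz|Hz].
  - assert (Hsmall : forall w : C, fst w <= X' -> A * mu * Cmod (cexp w) <= / 2).
    { intros w Hw. rewrite Cmod_cexp. apply Rmult_le_reg_r with (exp (- X')); [apply exp_pos|].
      rewrite HX' at 2. rewrite Rmult_assoc, <- exp_plus.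
      apply Rle_trans with (A * mu * 1).
      - apply Rmult_le_compat_l; [nra|]. rewrite <- exp_0. apply exp_le_compat. lra.
      - nra. }
    set (g := fun w : C => (f w - partial_sum a (cexp w) p)%C).
    assert (HSp : forall w : C, fst w <= X' -> Cmod (partial_sum a (cexp w) p) <= 2 * K).
    { intros w Hw.
      assert (W := partial_sum_diff_le M a K A mu 0 p (cexp w) ltac:(lra) ltac:(lra) ltac:(lra)
        (HM 0%nat) Ha).
      simpl in W. rewrite HM0 in W.
      replace (partial_sum a (cexp w) p - 0)%C with (partial_sum a (cexp w) p) in W by ring.
      rewrite !Rmult_1_r in W. apply W; [|now apply Hsmall].
      intros j Hj. rewrite Rmult_1_l. now apply HMmu. }
    assert (Hg := half_strip_two_constants g X' theta Y (C0 + 2 * K) (INR p) HY (pos_INR p)).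
    assert (Hgz : Cmod (g z) <= (C0 + 2 * K) * exp (INR p * (fst z - X') * ((Y - snd z) / (Y - theta)))).
    { apply Hg; [| |easy|easy].
      - intros w Hw1 Hw2. destruct (Hf w ltac:(lra) Hw2) as [F1 F2]. split.
        + apply (cdiff_minus f); [easy|apply cdiff_partial_sum].
        + eapply Rle_trans; [apply Cmod_triangle_minus|]. specialize (HSp w Hw1). lra.
      (* On theta, A <= B and M_p <= mu^p turn K A^p M_p |z|^p into K (B mu |z|)^p. *)
      - intros x Hx. eapply Rle_trans; [apply Hth; lra|].
        replace (INR p * (x - X')) with (INR p * x + INR p * (- X')) by ring.
        rewrite exp_plus, !exp_pow_INR, HX'.
        rewrite (Rmult_comm (exp x ^ p)), <- Rmult_assoc.
        apply Rmult_le_compat_r; [apply pow_le; left; apply exp_pos|].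
        rewrite Rpow_mult_distr, <- Rmult_assoc.
        apply Rmult_le_compat.
        + apply Rmult_le_pos; [lra|apply pow_le; lra].
        + left; apply HM.
        + apply Rmult_le_compat; [lra|apply pow_le; lra|lra|apply pow_incr; lra].
        + now apply HMmu. }
    assert (Hgz' : Cmod (g z) <= (C0 + 2 * K) * (B * mu * r) ^ q).
    { eapply Rle_trans; [exact Hgz|]. apply Rmult_le_compat_l; [lra|].
      rewrite <- HX'. unfold r. rewrite <- exp_plus, <- exp_pow_INR. apply exp_le_compat.
      unfold p. rewrite mult_INR.
      set (lam := (Y - snd z) / (Y - theta)) in *.
      assert (Hq := pos_INR q).
      assert (H1 : 1 <= INR k * lam).
      { apply Rle_trans with (INR k * delta); [lra|]. apply Rmult_le_compat_l; [apply pos_INR|easy]. }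
      replace (INR k * INR q * (fst z - X') * lam) with (- (INR q * (X' - fst z) * (INR k * lam))) by ring.
      replace (INR q * (- X' + fst z)) with (- (INR q * (X' - fst z))) by ring.
      apply Ropp_le_contravar.
      assert (0 <= INR q * (X' - fst z)) by (apply Rmult_le_pos; lra). nra. }
    assert (HSq : Cmod (partial_sum a (cexp z) p - partial_sum a (cexp z) q) <=
      2 * K * A ^ q * M q * r ^ q).
    { replace p with (q + (p - q))%nat by lia. rewrite <- Hcr.
      apply (partial_sum_diff_le M a K A mu); try lra; [easy| |now apply Hsmall].
      intros j Hj. apply weight_le; [easy|easy|lia]. }
    replace (f z - partial_sum a (cexp z) q)%C
      with (g z + (partial_sum a (cexp z) p - partial_sum a (cexp z) q))%C by (unfold g; ring).
    eapply Rle_trans; [apply Cmod_triangle|]. eapply Rle_trans; [|apply (Hlast (C0 + 2 * K)); lra].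
    apply Rplus_le_compat.
    + eapply Rle_trans; [exact Hgz'|]. apply Rmult_le_compat_l; [lra|easy].
    + eapply Rle_trans; [exact HSq|].
      apply Rmult_le_compat_r; [apply pow_le; lra|]. apply Rmult_le_compat_r; [lra|].
      rewrite <- (Rmult_1_r (2 * K * A ^ q)). apply Rmult_le_compat.
      * apply Rmult_le_pos; [lra|apply pow_le; lra].
      * lra.
      * apply Rmult_le_compat_l; [lra|]. apply pow_incr; lra.
      * now apply pow_R1_Rle.
  (* Here 1 <= (B mu r)^q <= (B E)^q M_q r^q, so constants are already of the required order, and so
     are the terms M_n r^n with n <= q. *)
  - assert (Hbig : 1 <= B * mu * r).
    { rewrite <- HX'. unfold r. rewrite <- exp_plus, <- exp_0. apply exp_le_compat. lra. }
    assert (HfC : Cmod (f z) <= C0 * ((B * E) ^ q * M q * r ^ q)).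
    { apply Rle_trans with (C0 * 1); [rewrite Rmult_1_r; now apply Hf|].
      apply Rmult_le_compat_l; [easy|].
      apply Rle_trans with ((B * mu * r) ^ q); [now apply pow_R1_Rle|easy]. }
    assert (HSq : Cmod (partial_sum a (cexp z) q) <= K * (2 * A1 * (B * E)) ^ q * M q * r ^ q).
    { rewrite <- Hcr. apply partial_sum_le; [lra|lra|lra|easy|easy|]. rewrite Hcr.
      intros n Hn. eapply Rle_trans; [|exact HBmuq].
      apply Rle_trans with ((B * mu * r) ^ n); [|apply Rle_pow; [easy|lia]].
      rewrite Rpow_mult_distr. apply Rmult_le_compat_r; [apply pow_le; lra|].
      eapply Rle_trans; [apply HMmu; lia|]. apply pow_incr. nra. }
    eapply Rle_trans; [apply Cmod_triangle_minus|].
    eapply Rle_trans; [apply Rplus_le_compat; [exact HfC|exact HSq]|].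
    rewrite (Rpow_mult_distr (2 * A1)).
    set (U := (B * E) ^ q * M q * r ^ q).
    assert (HU : 0 <= U).
    { unfold U. apply Rmult_le_pos; [apply Rmult_le_pos; [apply pow_le|]|apply pow_le]; lra. }
    assert (P1 : 1 <= (2 * A1) ^ q) by (apply pow_R1_Rle; lra).
    replace (K * ((2 * A1) ^ q * (B * E) ^ q) * M q * r ^ q) with (K * (2 * A1) ^ q * U) by (unfold U; ring).
    replace ((C0 + 2 * K + 2 * K) * ((2 * A1) ^ q * (B * E) ^ q) * M q * r ^ q)
      with (C0 * (2 * A1) ^ q * U + 4 * K * (2 * A1) ^ q * U) by (unfold U; ring).
    apply Rplus_le_compat.
    + apply Rmult_le_compat_r; [easy|]. rewrite <- (Rmult_1_r C0) at 1. apply Rmult_le_compat_l; easy.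
    + apply Rmult_le_compat_r; [easy|]. apply Rmult_le_compat_r; lra.
Qed.

(** a_n z^n is the difference of two consecutive remainders; after division by |z|^n the second one
    vanishes as z tends to the vertex along theta. *)
Lemma expansion_coeff_le (M : nat -> R) (f : C -> C) (a : nat -> C) (X theta K A : R) :
  (forall p, 0 < M p) -> 0 < K -> 0 < A ->
  (forall x, x <= X -> forall p,
    Cmod (f (x, theta) - partial_sum a (cexp (x, theta)) p) <= K * A ^ p * M p * exp x ^ p) ->
  forall n, Cmod (a n) <= K * A ^ n * M n.
Proof.
  intros HM HK HA H n. apply Rnot_lt_le. intros Hlt.
  set (c := K * A ^ S n * M (S n)).
  assert (Hc : 0 < c).
  { unfold c. apply Rmult_lt_0_compat; [|apply HM]. apply Rmult_lt_0_compat; [easy|now apply pow_lt]. }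
  set (eta := (Cmod (a n) - K * A ^ n * M n) / c).
  assert (Heta : 0 < eta) by (apply Rdiv_lt_0_compat; lra).
  (* At this x the second remainder contributes at most c eta / 2, half of the assumed excess. *)
  set (x := Rmin X (ln (eta / 2))).
  assert (Hx1 : x <= X) by apply Rmin_l.
  assert (Hx2 : exp x <= eta / 2).
  { rewrite <- (exp_ln (eta / 2)) by lra. apply exp_le_compat, Rmin_r. }
  assert (B0 := H x Hx1 n). assert (B1 := H x Hx1 (S n)).
  set (w := cexp (x, theta)) in *.
  assert (Hw : Cmod w = exp x) by apply Cmod_cexp.
  assert (Hr : 0 < exp x) by apply exp_pos.
  assert (B : Cmod (a n) * exp x ^ n <= (K * A ^ n * M n + c * exp x) * exp x ^ n).
  { rewrite <- Hw, <- Cmod_pow, <- Cmod_mult, Cmod_pow, Hw.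
    replace (a n * w ^ n)%C with ((f (x, theta) - partial_sum a w n) - (f (x, theta) - partial_sum a w (S n)))%C
      by (simpl partial_sum; ring).
    eapply Rle_trans; [apply Cmod_triangle_minus|].
    eapply Rle_trans; [apply Rplus_le_compat; [exact B0|exact B1]|].
    right. unfold c. simpl. ring. }
  apply Rmult_le_reg_r in B; [|now apply pow_lt].
  assert (c * exp x <= c * (eta / 2)) by (apply Rmult_le_compat_l; lra).
  assert (E : c * eta = Cmod (a n) - K * A ^ n * M n) by (unfold eta; field; lra). nra.
Qed.

(** * Closures of sectors and proper bounded subsectors *)

Lemma closure_self (A : log_surface -> Prop) (z : log_surface) : A z -> closure A z.
Proof. intros Hz U HU. exists z. split; [now apply locally_singleton|easy]. Qed.

Lemma closure_sector_le (d g r : R) (z : log_surface) : 0 < r ->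
  closure (sector d g r) z -> Rabs (arg z - d) <= PI * g / 2 /\ modulus z <= r.
Proof.
  intros Hr Hz. split; apply Rnot_lt_le; intros Hlt.
  - set (e := Rabs (arg z - d) - PI * g / 2). assert (He : 0 < e) by (unfold e; lra).
    destruct (Hz (ball z (mkposreal e He)) (locally_ball z _)) as [w [[_ Hw] [Hs _]]].
    change (Rabs (arg w - arg z) < e) in Hw. unfold e in Hw.
    assert (T := Rabs_triang (arg w - d) (- (arg w - arg z))).
    rewrite Rabs_Ropp in T. replace (arg w - d + - (arg w - arg z)) with (arg z - d) in T by ring. lra.
  - assert (Hl : ln r < fst z).
    { apply exp_lt_inv. rewrite exp_ln by easy. exact Hlt. }
    assert (He : 0 < fst z - ln r) by lra.
    destruct (Hz (ball z (mkposreal _ He)) (locally_ball z _)) as [w [[Hw _] [_ Hs]]].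
    change (Rabs (fst w - fst z) < fst z - ln r) in Hw. apply Rabs_lt_between in Hw.
    assert (Hl' : ln r < fst w) by lra. apply exp_increasing in Hl'.
    rewrite exp_ln in Hl' by easy. unfold modulus in Hs. lra.
Qed.

(** Contracting the argument towards d by a factor 1 - t moves (x, y) into the open sector by an
    arbitrarily small step. *)
Lemma closure_sector_side (d g r x y : R) : 0 < g -> exp x < r ->
  Rabs (y - d) <= PI * g / 2 -> closure (sector d g r) (x, y).
Proof.
  intros Hg Hx Hy U [e HU]. assert (He := cond_pos e). assert (HPI := PI_RGT_0).
  assert (Hpg : 0 < PI * g / 2) by nra.
  assert (Hyd := Rabs_pos (y - d)).
  set (t := Rmin (1 / 2) (e / (2 * (Rabs (y - d) + 1)))).
  assert (Ht0 : 0 < t) by (apply Rmin_pos; [lra|apply Rdiv_lt_0_compat; lra]).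
  assert (Ht1 : t <= 1 / 2) by apply Rmin_l.
  assert (Ht2 : t * (2 * (Rabs (y - d) + 1)) <= e).
  { apply Rle_trans with (e / (2 * (Rabs (y - d) + 1)) * (2 * (Rabs (y - d) + 1))).
    - apply Rmult_le_compat_r; [lra|apply Rmin_r].
    - right. field. lra. }
  exists ((x, d + (y - d) * (1 - t)) : log_surface). split.
  - apply HU. split.
    + apply ball_center.
    + change (Rabs (d + (y - d) * (1 - t) - y) < e).
      replace (d + (y - d) * (1 - t) - y) with (- (t * (y - d))) by ring.
      rewrite Rabs_Ropp, Rabs_mult, (Rabs_pos_eq t) by lra. nra.
  - split; [|exact Hx]. unfold arg; simpl.
    replace (d + (y - d) * (1 - t) - d) with ((y - d) * (1 - t)) by ring.
    rewrite Rabs_mult, (Rabs_pos_eq (1 - t)) by lra. nra.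
Qed.

Lemma sectorial_region_subsector (gamma Th : R) (G : log_surface -> Prop) :
  sectorial_region gamma G -> 0 <= Th < PI * gamma / 2 ->
  exists r T, 0 < r /\ proper_bounded_subsector T G /\
    forall z, Rabs (arg z) <= Th -> modulus z < r -> T z.
Proof.
  intros (_ & _ & _ & HG) HTh. assert (HPI := PI_RGT_0).
  (* Th < k1 < k2 < PI gamma / 2: the sector of half-angle k2 lies in G for a small radius and
     contains the closure of the one of half-angle k1 and half that radius. *)
  set (k1 := (2 * Th + PI * gamma / 2) / 3). set (k2 := (Th + 2 * (PI * gamma / 2)) / 3).
  assert (Hang : forall k, PI * (2 * k / PI) / 2 = k) by (intros; field; lra).
  destruct (HG (2 * k2 / PI)) as (rho & Hrho & Hsec).
  { split.
    - apply Rdiv_lt_0_compat; [unfold k2|]; lra.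
    - apply Rmult_lt_reg_r with PI; [easy|]. unfold Rdiv. rewrite Rmult_assoc, Rinv_l by lra.
      unfold k2; lra. }
  exists (rho / 2), (sector 0 (2 * k1 / PI) (rho / 2)). split; [lra|]. split; [split|].
  - exists 0, (2 * k1 / PI), (rho / 2). split; [|split; [lra|easy]].
    apply Rdiv_lt_0_compat; [unfold k1|]; lra.
  - intros z Hz. apply closure_sector_le in Hz; [|lra]. rewrite Hang in Hz.
    apply Hsec. split; [rewrite Hang; unfold k1, k2 in *; lra|lra].
  - intros z H1 H2. split; [|easy]. rewrite Hang, Rminus_0_r. unfold k1. lra.
Qed.

(** The two bounding directions of T occur in its closure, hence in G, so they lie strictly inside
    the opening; this leaves room for strips wider than T. *)
Lemma proper_bounded_subsector_angle (gamma : R) (T G : log_surface -> Prop) :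
  (forall z, G z -> unbounded_sector 0 gamma z) -> proper_bounded_subsector T G ->
  exists Th, 0 <= Th < PI * gamma / 2 /\ forall z, T z -> Rabs (arg z) <= Th.
Proof.
  intros HG ((d & g & r & Hg & Hr & HT) & Hcl). assert (HPI := PI_RGT_0).
  assert (Hpg : 0 < PI * g / 2) by nra.
  assert (Hside : forall y, Rabs (y - d) <= PI * g / 2 -> Rabs y < PI * gamma / 2).
  { intros y Hy.
    assert (Hx : exp (ln r - 1) < r).
    { rewrite <- (exp_ln r Hr) at 2. apply exp_increasing. lra. }
    assert (C := closure_sector_side d g r (ln r - 1) y Hg Hx Hy).
    assert (C' : closure T (ln r - 1, y)).
    { intros U HU. destruct (C U HU) as [w [Hw1 Hw2]]. exists w. split; [easy|]. now apply HT. }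
    apply Hcl, HG in C'. unfold unbounded_sector in C'. now rewrite Rminus_0_r in C'. }
  assert (S1 := Hside (d + PI * g / 2)). assert (S2 := Hside (d - PI * g / 2)).
  replace (d + PI * g / 2 - d) with (PI * g / 2) in S1 by ring.
  replace (d - PI * g / 2 - d) with (- (PI * g / 2)) in S2 by ring.
  rewrite Rabs_Ropp in S2. rewrite (Rabs_pos_eq (PI * g / 2)) in S1, S2 by lra.
  specialize (S1 (Rle_refl _)). specialize (S2 (Rle_refl _)).
  exists (Rmax (Rabs (d + PI * g / 2)) (Rabs (d - PI * g / 2))). split; [split|].
  - eapply Rle_trans; [apply Rabs_pos|apply Rmax_l].
  - now apply Rmax_lub_lt.
  - intros z Hz. apply HT in Hz. destruct Hz as [Hz _]. apply Rabs_lt_between in Hz.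
    assert (B1 := Rmax_l (Rabs (d + PI * g / 2)) (Rabs (d - PI * g / 2))).
    assert (B2 := Rmax_r (Rabs (d + PI * g / 2)) (Rabs (d - PI * g / 2))).
    assert (B3 := Rle_abs (d + PI * g / 2)).
    assert (B4 := Rle_abs (- (d - PI * g / 2))). rewrite Rabs_Ropp in B4.
    apply Rabs_le. lra.
Qed.

(** * Assembling the estimate on a subsector *)

Lemma expansion_bound_le (K K' A A' m r : R) (p : nat) :
  0 <= K <= K' -> 0 <= A <= A' -> 0 <= m -> 0 <= r ->
  K * A ^ p * m * r ^ p <= K' * A' ^ p * m * r ^ p.
Proof.
  intros HK HA Hm Hr. apply Rmult_le_compat_r; [now apply pow_le|].
  apply Rmult_le_compat_r; [easy|].
  apply Rmult_le_compat; [easy|now apply pow_le|easy|now apply pow_incr].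
Qed.

(** For |z| >= rho, passing from M_n |z|^n to the next index multiplies it by at least m_0 rho. A
    factor B per index makes this at least 1, so constants and lower-order terms are dominated by
    the term of order q. *)
Lemma bounded_expansion_away_from_vertex (M : nat -> R) (f : log_surface -> C)
    (a : nat -> C) (T : log_surface -> Prop) (K A rho : R) :
  (forall p, 0 < M p) -> M 0%nat = 1 -> log_convex M -> 0 < K -> 0 < A -> 0 < rho ->
  (forall n, Cmod (a n) <= K * A ^ n * M n) -> bounded_on f T ->
  exists K' A', 0 < K' /\ 0 < A' /\
    expansion_on M f a (fun z => T z /\ rho <= modulus z) K' A'.
Proof.
  intros HM HM0 HL HK HA Hrho Ha [C0 HC0].
  assert (Hm := quotients_pos M HM 0%nat).
  set (B := Rmax 1 (/ (quotients M 0 * rho))).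
  assert (HB : 1 <= B) by apply Rmax_l.
  assert (HB' : 1 <= B * (quotients M 0 * rho)).
  { apply Rle_trans with (/ (quotients M 0 * rho) * (quotients M 0 * rho)).
    - right. field. lra.
    - apply Rmult_le_compat_r; [|apply Rmax_r]. nra. }
  set (A1 := Rmax 1 A).
  assert (HA1 : 1 <= A1 /\ A <= A1) by (split; [apply Rmax_l|apply Rmax_r]).
  exists (Rabs C0 + K), (2 * A1 * B).
  split; [generalize (Rabs_pos C0); lra|]. split; [nra|].
  intros z [Hz Hzr] q. set (r := modulus z) in *.
  assert (Hcr : Cmod (proj z) = r) by apply Cmod_cexp.
  assert (HMr : forall n, (n <= q)%nat -> M n * r ^ n <= B ^ q * M q * r ^ q).
  { intros n Hn. destruct (Nat.le_exists_sub _ _ Hn) as [k [-> _]].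
    assert (W := weight_ge M HM HL n k 0 ltac:(lia)). rewrite (Nat.add_comm n k) in W.
    assert (Hu : 1 <= (B * (quotients M 0 * r)) ^ k).
    { apply pow_R1_Rle. eapply Rle_trans; [exact HB'|]. apply Rmult_le_compat_l; [lra|]. nra. }
    rewrite !Rpow_mult_distr in Hu.
    assert (HBn : 1 <= B ^ n) by (apply pow_R1_Rle; lra).
    assert (Hrn : 0 < r ^ n) by (apply pow_lt; lra).
    assert (Hrk : 0 < r ^ k) by (apply pow_lt; lra).
    assert (HBk : 0 < B ^ k) by (apply pow_lt; lra).
    assert (HMn := HM n). assert (HMk := HM (k + n)%nat).
    apply Rle_trans with (M n * r ^ n * (B ^ k * (quotients M 0 ^ k * r ^ k))).
    - rewrite <- (Rmult_1_r (M n * r ^ n)) at 1. apply Rmult_le_compat_l; [nra|easy].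
    - rewrite !pow_add.
      replace (M n * r ^ n * (B ^ k * (quotients M 0 ^ k * r ^ k))) with
        ((M n * quotients M 0 ^ k) * (B ^ k * (r ^ k * r ^ n))) by ring.
      apply Rle_trans with (M (k + n)%nat * (B ^ k * (r ^ k * r ^ n))).
      + apply Rmult_le_compat_r; [|easy]. left. repeat apply Rmult_lt_0_compat; easy.
      + replace (B ^ k * B ^ n * M (k + n)%nat * (r ^ k * r ^ n)) with
          (M (k + n)%nat * (B ^ k * (r ^ k * r ^ n)) * B ^ n) by ring.
        rewrite <- (Rmult_1_r (M (k + n)%nat * (B ^ k * (r ^ k * r ^ n)))) at 1.
        apply Rmult_le_compat_l; [|easy]. left. repeat apply Rmult_lt_0_compat; easy. }
  assert (HS : Cmod (partial_sum a (proj z) q) <= K * (2 * A1 * B) ^ q * M q * r ^ q).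
  { rewrite <- Hcr. apply partial_sum_le; [lra|lra|lra|apply HM| |rewrite Hcr; exact HMr].
    intros n. eapply Rle_trans; [apply Ha|].
    apply Rmult_le_compat_r; [left; apply HM|]. apply Rmult_le_compat_l; [lra|].
    apply pow_incr. lra. }
  assert (H1 : 1 <= (2 * A1 * B) ^ q * M q * r ^ q).
  { assert (H0 := HMr 0%nat ltac:(lia)). simpl in H0. rewrite HM0, Rmult_1_l in H0.
    eapply Rle_trans; [exact H0|]. apply Rmult_le_compat_r; [apply pow_le; lra|].
    apply Rmult_le_compat_r; [left; apply HM|]. apply pow_incr. nra. }
  eapply Rle_trans; [apply Cmod_triangle_minus|].
  assert (HC := HC0 z Hz). assert (HCa := Rle_abs C0). assert (HCp := Rabs_pos C0).
  set (U := (2 * A1 * B) ^ q * M q * r ^ q) in *.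
  replace ((Rabs C0 + K) * (2 * A1 * B) ^ q * M q * r ^ q)
    with (Rabs C0 * U + K * (2 * A1 * B) ^ q * M q * r ^ q) by (unfold U; ring).
  apply Rplus_le_compat; [|exact HS].
  apply Rle_trans with (Rabs C0 * 1); [lra|]. now apply Rmult_le_compat_l.
Qed.

Lemma A_tilde_of_expansion_in_direction (M : nat -> R) (gamma theta : R)
    (G : log_surface -> Prop) (f : log_surface -> C) (a : nat -> C) :
  (forall p, 0 < M p) -> M 0%nat = 1 -> log_convex M ->
  is_lim_seq (quotients M) p_infty -> admits_nonzero_proximate_order M ->
  sectorial_region gamma G -> Rabs theta < PI * gamma / 2 ->
  holomorphic_on f G ->
  (forall T, proper_bounded_subsector T G -> bounded_on f T) ->
  has_expansion_in_direction M G f a theta ->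
  forall T, proper_bounded_subsector T G ->
    exists K A, 0 < K /\ 0 < A /\ expansion_on M f a T K A.
Proof.
  intros HM HM0 HL Hinf Hadm HG Hth Hhol Hbd (r & K & A & Hr & HK & HA & _ & Hexp) T HT.
  destruct (quotients_pow_le M HM HM0 HL Hinf Hadm) as (D & HD & HDN).
  destruct (proper_bounded_subsector_angle gamma T G ltac:(apply HG) HT) as (Th0 & HTh0 & HTarg).
  set (Th := Rmax (Rabs theta) Th0).
  assert (HTh : Rabs theta <= Th /\ Th0 <= Th /\ Th < PI * gamma / 2).
  { split; [apply Rmax_l|]. split; [apply Rmax_r|]. now apply Rmax_lub_lt. }
  (* The half-strips end at k and - k, beyond all arguments of T and beyond theta, yet strictly
     inside the opening. *)
  set (k := (Th + PI * gamma / 2) / 2).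
  assert (Hk : Th < k < PI * gamma / 2) by (unfold k; lra).
  destruct (sectorial_region_subsector gamma k G HG ltac:(lra)) as (r0 & T0 & Hr0 & HT0 & HT0in).
  destruct (Hbd T0 HT0) as [C0 HC0].
  set (X := Rmin (ln r) (ln (r0 / 2))).
  assert (HX1 : exp X <= r).
  { rewrite <- (exp_ln r Hr). apply exp_le_compat, Rmin_l. }
  assert (HX2 : exp X < r0).
  { apply Rle_lt_trans with (r0 / 2); [|lra].
    rewrite <- (exp_ln (r0 / 2)) by lra. apply exp_le_compat, Rmin_r. }
  assert (Hstrip : forall z : C, fst z <= X -> Rabs (snd z) <= k -> cdiff f z /\ Cmod (f z) <= C0).
  { intros z Hz1 Hz2.
    assert (HzT : T0 z).
    { apply HT0in; [exact Hz2|]. eapply Rle_lt_trans; [|exact HX2]. now apply exp_le_compat. }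
    split; [|now apply HC0].
    apply (holomorphic_on_cdiff f G Hhol). apply HT0. now apply closure_self. }
  assert (Hdir : forall x, x <= X -> forall p,
    Cmod (f ((x, theta) : C) - partial_sum a (cexp (x, theta)) p) <= K * A ^ p * M p * exp x ^ p).
  { intros x Hx p. apply (Hexp ((x, theta) : log_surface)). split; [reflexivity|].
    eapply Rle_trans; [|exact HX1]. now apply exp_le_compat. }
  assert (Ha := expansion_coeff_le M f a X theta K A HM HK HA Hdir).
  (* A lower bound for lambda on T: the distance to the far side is at least k - Th and the width of
     either strip is at most 2 k. *)
  set (delta := (k - Th) / (2 * k)).
  assert (Hdelta : 0 < delta).
  { assert (B := Rabs_pos theta). apply Rdiv_lt_0_compat; lra. }
  assert (Hthb : - Th <= theta <= Th) by (apply Rabs_le_between; lra).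
  assert (Hfrac : forall u v, k - Th <= u -> 0 < v <= 2 * k -> delta <= u / v).
  { intros u v Hu Hv. apply Rle_trans with ((k - Th) / v).
    - unfold delta, Rdiv. apply Rmult_le_compat_l; [lra|]. apply Rinv_le_contravar; lra.
    - apply Rmult_le_compat_r; [left; apply Rinv_0_lt_compat; lra|easy]. }
  destruct (half_strip_expansion M f a D X theta k K A C0 delta HM HM0 HL HD HDN
    ltac:(lra) HK HA Hdelta) as (K1 & A1 & HK1 & HA1 & H1); [|exact Ha|exact Hdir|].
  { intros z Hz1 Hz2. rewrite Rmin_left, Rmax_right in Hz2 by lra.
    apply Hstrip; [easy|]. apply Rabs_le; lra. }
  destruct (half_strip_expansion M f a D X theta (- k) K A C0 delta HM HM0 HL HD HDN
    ltac:(lra) HK HA Hdelta) as (K2 & A2 & HK2 & HA2 & H2); [|exact Ha|exact Hdir|].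
  { intros z Hz1 Hz2. rewrite Rmin_right, Rmax_left in Hz2 by lra.
    apply Hstrip; [easy|]. apply Rabs_le; lra. }
  destruct (bounded_expansion_away_from_vertex M f a T K A (exp X) HM HM0 HL HK HA
    (exp_pos X) Ha (Hbd T HT)) as (K3 & A3 & HK3 & HA3 & H3).
  exists (K1 + K2 + K3), (A1 + A2 + A3). split; [lra|]. split; [lra|].
  intros [x y] Hz p. simpl in x, y.
  assert (HMp := HM p).
  destruct (Rle_lt_dec x X) as [HxX|HxX].
  - assert (Hy : - Th <= y <= Th).
    { assert (B := HTarg _ Hz). unfold arg in B; simpl in B. apply Rabs_le_between. lra. }
    destruct (Rle_lt_dec theta y) as [Hs|Hs].
    + eapply Rle_trans; [apply (H1 (x, y) HxX); simpl|apply expansion_bound_le; [lra..|left; apply exp_pos]].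
      * rewrite Rmin_left, Rmax_right; lra.
      * apply Hfrac; lra.
    + eapply Rle_trans; [apply (H2 (x, y) HxX); simpl|apply expansion_bound_le; [lra..|left; apply exp_pos]].
      * rewrite Rmin_right, Rmax_left; lra.
      * replace ((- k - y) / (- k - theta)) with ((k + y) / (k + theta)) by (field; lra).
        apply Hfrac; lra.
  - eapply Rle_trans; [apply H3|apply expansion_bound_le; [lra..|left; apply exp_pos]].
    split; [easy|]. left. now apply exp_increasing.
Qed.

Theorem corollary5p3 :
  forall (M : nat -> R) (gamma theta : R) (G : log_surface -> Prop),
    (forall p, 0 < M p) ->
    M 0%nat = 1 ->
    log_convex M ->
    is_lim_seq (quotients M) p_infty ->
    admits_nonzero_proximate_order M ->
    0 < gamma ->
    sectorial_region gamma G ->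
    - (PI * gamma / 2) < theta < PI * gamma / 2 ->
    forall f : log_surface -> C,
      A_tilde M G f <->
      (holomorphic_on f G /\
       (forall T, proper_bounded_subsector T G -> bounded_on f T) /\
       admits_expansion_in_direction M G f theta).
Proof.
  intros M gamma theta G HM HM0 HL Hinf Hadm _ HG Hth f.
  assert (Hth' : Rabs theta < PI * gamma / 2) by (apply Rabs_lt_between; lra).
  split.
  - intros [Hhol [a Ha]]. split; [easy|]. split.
    (* The estimate of order 0 is boundedness, since the partial sum is empty and M_0 = 1. *)
    + intros T HT. destruct (Ha T HT) as (K & A & _ & _ & H).
      exists K. intros z Hz. specialize (H z Hz 0%nat). simpl in H.
      rewrite HM0, !Rmult_1_r in H.
      replace (f z) with (f z - 0)%C by ring. exact H.
    + exists a.
      destruct (sectorial_region_subsector gamma (Rabs theta) G HG) as (r & T & Hr & HT & HTin).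
      { split; [apply Rabs_pos|easy]. }
      (* The segment contains its far endpoint whereas T needs modulus below r, hence r / 2. *)
      assert (Hseg : forall z, segment theta (r / 2) z -> T z).
      { intros z [H1 H2]. apply HTin; [rewrite H1; lra|lra]. }
      destruct (Ha T HT) as (K & A & HK & HA & H).
      exists (r / 2), K, A. split; [lra|]. split; [easy|]. split; [easy|]. split.
      * intros z Hz. apply HT. apply closure_self. now apply Hseg.
      * intros z Hz. now apply H, Hseg.
  - intros (Hhol & Hbd & a & Ha). split; [easy|]. exists a.
    now apply (A_tilde_of_expansion_in_direction M gamma theta G f a).
Qed.
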